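(* If $\mathcal{A}$ is a unital separable approximately divisible C$^*$-algebra, then $\mathcal{A}$ is singly generated, i.e., $\mathcal{A}$ is generated as a C$^*$-algebra by two self-adjoint elements of $\mathcal{A}$.
   Context: For a finite-dimensional C$^*$-algebra $\mathcal{B}\cong M_{k_1}(\mathbb{C})\oplus\cdots\oplus M_{k_r}(\mathbb{C})$, define $\mathrm{SubRank}(\mathcal{B})=\min\{k_1,\ldots,k_r\}$. A separable unital C$^*$-algebra $\mathcal{A}$ with unit $I_{\mathcal{A}}$ is approximately divisible if, for every $x_1,\ldots,x_n\in\mathcal{A}$ and $\varepsilon>0$, there is a finite-dimensional C$^*$-subalgebra $\mathcal{B}$ of $\mathcal{A}$ such that (1) $I_{\mathcal{A}}\in\mathcal{B}$; (2) $\mathrm{SubRank}(\mathcal{B})\ge 2$; (3) $\|x_iy-yx_i\|<\varepsilon$ for $i=1,\ldots,n$ and all $y\in\mathcal{B}$ with $\|y\|\le 1$. *)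

(* Defs.v *)
From HB Require Import structures.
From mathcomp Require Import all_boot all_order all_algebra.
From mathcomp Require Import sesquilinear spectral complex.
From mathcomp Require Import all_classical all_reals all_analysis.

Set Implicit Arguments.
Unset Strict Implicit.
Unset Printing Implicit Defensive.

Import Order.TTheory GRing.Theory Num.Theory.
Import numFieldNormedType.Exports.

Local Open Scope classical_set_scope.
Local Open Scope ring_scope.
Local Open Scope complex_scope.
Local Open Scope sesquilinear_scope.

(* The norm of a normed module over R[i] takes its values in R[i], where
   comparability forces differences to be real: `|x| is a nonnegative real.

   The library's hierarchy has no structure inheriting from both its rings and
   its normed modules over another ring, so the multiplication is part of this
   mixin; the instances below make every C*-algebra a GRing.Algebra over R[i]
   on the same carrier. *)
HB.mixin Record isCstarAlgebra (R : realType) A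
    & CompleteNormedModule R[i] A := {
  cstar_one : A;
  cstar_mul : A -> A -> A;
  cstar_mulA : associative cstar_mul;
  cstar_mul1l : left_id cstar_one cstar_mul;
  cstar_mul1r : right_id cstar_one cstar_mul;
  cstar_mulDl : left_distributive cstar_mul +%R;
  cstar_mulDr : right_distributive cstar_mul +%R;
  cstar_oner_neq0 : cstar_one != 0;
  cstar_scaleAl : forall (c : R[i]) (x y : A),
    c *: cstar_mul x y = cstar_mul (c *: x) y;
  cstar_scaleAr : forall (c : R[i]) (x y : A),
    c *: cstar_mul x y = cstar_mul x (c *: y);
  star : A -> A;
  starK : involutive star;
  star_conj_linear : forall (c : R[i]) (x y : A),
    star (c *: x + y) = Num.conj c *: star x + star y;
  cstar_starM : forall x y : A,
    star (cstar_mul x y) = cstar_mul (star y) (star x);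
  cstar_normM : forall x y : A, `|cstar_mul x y| <= `|x| * `|y|;
  cstar_normsq : forall x : A, `|cstar_mul (star x) x| = `|x| ^+ 2
}.

#[short(type="cstarAlgType")]
HB.structure Definition CstarAlgebra (R : realType) :=
  { A of isCstarAlgebra R A & CompleteNormedModule R[i] A }.

Section CstarAlgebraRing.
Variables (R : realType) (A : cstarAlgType R).

HB.instance Definition _ := GRing.Zmodule_isNzRing.Build (CstarAlgebra.sort A)
  (@cstar_mulA R A) (@cstar_mul1l R A) (@cstar_mul1r R A)
  (@cstar_mulDl R A) (@cstar_mulDr R A) (@cstar_oner_neq0 R A).

HB.instance Definition _ :=
  GRing.Lmodule_isLalgebra.Build R[i] (CstarAlgebra.sort A)
    (@cstar_scaleAl R A).

HB.instance Definition _ :=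
  GRing.Lalgebra_isAlgebra.Build R[i] (CstarAlgebra.sort A)
    (@cstar_scaleAr R A).

Lemma starM (x y : A) : star (x * y) = star y * star x.
Proof. exact: cstar_starM. Qed.

Lemma cstar_norm_mul (x y : A) : `|x * y| <= `|x| * `|y|.
Proof. exact: cstar_normM. Qed.

Lemma cstar_identity (x : A) : `|star x * x| = `|x| ^+ 2.
Proof. exact: cstar_normsq. Qed.

End CstarAlgebraRing.

Section CstarAlgebraTheory.
Variables (R : realType) (A : cstarAlgType R).

Definition separable : Prop :=
  exists S : set A, countable S /\ dense S.

(* Not required to contain the unit of A. *)
Record cstar_subalgebra (B : set A) : Prop := CstarSubalgebra {
  cstar_sub_closed : closed B;
  cstar_sub0 : B 0;
  cstar_sub_linear : forall (c : R[i]) (x y : A), B x -> B y -> B (c *: x + y);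
  cstar_sub_mul : forall x y : A, B x -> B y -> B (x * y);
  cstar_sub_star : forall x : A, B x -> B (star x)
}.

Definition finite_dimensional (B : set A) : Prop :=
  exists (n : nat) (e : 'I_n -> A), forall x : A, B x ->
    exists c : 'I_n -> R[i], x = \sum_(i < n) c i *: e i.

(* M_(k 0) (+) ... (+) M_(k r) is the type forall i, 'M[R[i]]_(k i) with
   componentwise operations; phi is a *-isomorphism from it onto B. *)
Record direct_sum_star_iso (B : set A) (r : nat) (k : 'I_r.+1 -> nat)
    (phi : (forall i : 'I_r.+1, 'M[R[i]]_(k i)) -> A) : Prop :=
  DirectSumStarIso {
    dssi_bij : set_bij [set: forall i : 'I_r.+1, 'M[R[i]]_(k i)] B phi;
    dssi_linear : forall (c : R[i]) (x y : forall i : 'I_r.+1, 'M[R[i]]_(k i)),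
      phi (fun i => c *: x i + y i) = c *: phi x + phi y;
    dssi_mul : forall x y : forall i : 'I_r.+1, 'M[R[i]]_(k i),
      phi (fun i => x i *m y i) = phi x * phi y;
    dssi_star : forall x : forall i : 'I_r.+1, 'M[R[i]]_(k i),
      phi (fun i => (x i)^t*) = star (phi x)
  }.

Definition block_sizes (B : set A) (r : nat) (k : 'I_r.+1 -> nat) : Prop :=
  (forall i, (0 < k i)%N) /\ exists phi, direct_sum_star_iso B (k := k) phi.

(* The block sizes of a finite-dimensional C*-algebra are unique up to order;
   the value is 0 if B has no such decomposition. *)
Definition SubRank (B : set A) : nat :=
  xget 0%N [set m | exists (r : nat) (k : 'I_r.+1 -> nat),
    block_sizes B k /\ m = \big[minn/k ord0]_(i < r.+1) k i].

Definition approximately_divisible : Prop :=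
  forall (n : nat) (x : 'I_n -> A) (eps : R), 0 < eps ->
    exists B : set A,
      [/\ cstar_subalgebra B, finite_dimensional B, B 1, (2 <= SubRank B)%N &
          forall (i : 'I_n) (y : A), B y -> `|y| <= 1 ->
            `|x i * y - y * x i| < eps%:C].

Definition cstar_generated (S : set A) : set A :=
  smallest cstar_subalgebra S.

Definition self_adjoint (x : A) : Prop := star x = x.

Definition singly_generated : Prop :=
  exists x : A, cstar_generated [set x] = setT.

End CstarAlgebraTheory.

Arguments separable {R} A.
Arguments approximately_divisible {R} A.
Arguments singly_generated {R} A.

(* Main.v *)
Require Import Defs.
From mathcomp Require Import all_boot all_order all_algebra.
From mathcomp Require Import sesquilinear complex.
From mathcomp Require Import all_classical all_reals all_analysis.
From mathcomp Require Import zify ring lra.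

Set Implicit Arguments.
Unset Strict Implicit.
Unset Printing Implicit Defensive.

Import Order.TTheory GRing.Theory Num.Theory.
Import numFieldNormedType.Exports.

Local Open Scope classical_set_scope.
Local Open Scope ring_scope.
Local Open Scope complex_scope.
Local Open Scope sesquilinear_scope.

(** The problem is to find one element [t = a + i b], with [a] and [b]
self-adjoint, such that every element of [A] is a limit of noncommutative
polynomials in [t] and [star t].

Membership in a generated algebra is an open condition up to small errors: if
[x] lies in the algebra generated by a set, then a slight perturbation of that
set generates an algebra coming close to [x] ([unital_hull_stable]). Hence it
suffices to construct a convergent sequence [t_n] for which the [n]-th term
generates an algebra passing near the [n]-th term of a dense sequence, each move
being small compared with what the earlier terms tolerate
([exists_cartesian_near]).

Room for the later moves is kept in a corner. Along with [t] goes a projection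
[q] such that [a q = 0], [q b q = 0], and such that [t] together with the corner
[q A q] generates [A] ([state]). To approach a given [x], only finitely many
self-adjoint elements [d] of [q A q] are needed, and they are fed into [t] one at
a time ([absorb_list]). This uses the structure given by approximate
divisibility: since all blocks of the finite-dimensional subalgebra have size at
least 2, it contains [w] and [z] which split the unit into three orthogonal
projections

  [w (star w) + (star w) w + (star z) z = 1],

where [w] moves the second onto the first, and [z] moves the third into the
second. Suppose for a moment that [w] and [z] commute with [q] and [d]. Then
[p = q w (star w)] is a smaller projection, and the element

  [w + star w + z + star z + (star w) w d (star w) w],

compressed to [q], has zero [p]-corner; cutting it with [p] and [q] gives back
first [q w], then [q z], and finally the piece of [d] under [(star w) w], which
the partial isometries spread over all of [q]. So [d] is recovered from [p], [q]
and a single new self-adjoint element, added to [b] with a small factor, while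
[A] is still generated by the new [t] and the corner under [p]. The real part [a]
is there to remember the projections: it receives a small multiple of [q - p], so
it has the form [sum_n k_n (q_n - q_(n+1))] with rapidly decreasing [k_n], and the
projections are limits of powers ([extension_gap]).

In reality everything commutes only approximately, and the recovery of [d] is
only approximate ([exists_encoding]), which is enough. The one object that has to
be exact is the new projection [p]; it is obtained from [q w (star w) q] by
iterating a polynomial ([projection_near]). With [p] an exact projection, the
invariants are preserved exactly: a set of conjugates of [p] that approximately
covers [q] already forces the whole corner [q A q] into the algebra
([corner_sub_of_smaller]). *)

(** * The real-valued norm *)
Section RealNorm.
Variables (R : realType) (A : cstarAlgType R).
Implicit Types x y : A.

Definition rnorm x : R := complex.Re `|x|.

Lemma normE x : `|x| = (rnorm x)%:C.
Proof. by rewrite RRe_real //; exact: (ger0_real (normr_ge0 x)). Qed.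

Lemma rnorm_ge0 x : 0 <= rnorm x.
Proof. rewrite -lecR -normE; exact: normr_ge0. Qed.

Lemma rnorm0 : rnorm 0 = 0.
Proof. by rewrite /rnorm normr0. Qed.

Lemma rnormN x : rnorm (- x) = rnorm x.
Proof. by rewrite /rnorm normrN. Qed.

Lemma rnormB x y : rnorm (x - y) = rnorm (y - x).
Proof. by rewrite /rnorm distrC. Qed.

Lemma rnormD x y : rnorm (x + y) <= rnorm x + rnorm y.
Proof. by rewrite -lecR rmorphD /= -!normE; exact: ler_normD. Qed.

Lemma rnormD3 x y z : rnorm (x - z) <= rnorm (x - y) + rnorm (y - z).
Proof. by rewrite (le_trans _ (rnormD _ _)) // addrA subrK. Qed.

Lemma rnorm0_eq0 x : rnorm x = 0 -> x = 0.
Proof. by move=> x0; apply/normr0_eq0; rewrite normE x0. Qed.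

Lemma rnormM x y : rnorm (x * y) <= rnorm x * rnorm y.
Proof. by rewrite -lecR rmorphM /= -!normE; exact: cstar_norm_mul. Qed.

Lemma rnormZ c x : rnorm (c *: x) = complex.Re `|c| * rnorm x.
Proof.
by rewrite /rnorm normrZ normE; case: `|c| => u v /=; rewrite mulr0 subr0.
Qed.

Lemma rnormZr (c : R) x : rnorm (c%:C *: x) = `|c| * rnorm x.
Proof. by rewrite rnormZ normc_def /= expr0n addr0 sqrtr_sqr. Qed.

Lemma rnorm_star2 x : rnorm (star x * x) = rnorm x ^+ 2.
Proof. by apply: (@complexI R); rewrite rmorphXn /= -!normE cstar_identity. Qed.

Lemma starD x y : star (x + y) = star x + star y.
Proof. by rewrite -[x]scale1r star_conj_linear rmorph1 !scale1r. Qed.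

Lemma star0 : star (0 : A) = 0.
Proof. by apply: (addrI (star (0 : A))); rewrite -starD !addr0. Qed.

Lemma starZ c x : star (c *: x) = Num.conj c *: star x.
Proof. by rewrite -[c *: x]addr0 star_conj_linear star0 addr0. Qed.

Lemma starN x : star (- x) = - star x.
Proof. by rewrite -scaleN1r starZ rmorphN rmorph1 scaleN1r. Qed.

Lemma starB x y : star (x - y) = star x - star y.
Proof. by rewrite starD starN. Qed.

Lemma starZr (c : R) x : star (c%:C *: x) = c%:C *: star x.
Proof. by rewrite starZ; congr (_ *: _); exact: conjc_real. Qed.

Lemma star1 : star (1 : A) = 1.
Proof. by have := starM (star (1 : A)) 1; rewrite mulr1 !starK mulr1. Qed.

Lemma rnorm_star x : rnorm (star x) = rnorm x.
Proof.
have H (y : A) : rnorm y <= rnorm (star y).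
  have [->|y0] := eqVneq (rnorm y) 0; first exact: rnorm_ge0.
  have y1 : 0 < rnorm y by rewrite lt_neqAle eq_sym y0 rnorm_ge0.
  by rewrite -(ler_pM2r y1) -expr2 -rnorm_star2 rnormM.
by apply/eqP; rewrite eq_le H -{2}[x]starK H.
Qed.

Lemma rnorm1 : rnorm 1 = 1.
Proof.
have := rnorm_star2 1; rewrite star1 mulr1 => h.
have n0 : rnorm (1 : A) != 0.
  by apply/eqP => /rnorm0_eq0/eqP; rewrite oner_eq0.
by apply: (mulIf n0); rewrite mul1r -expr2.
Qed.

Lemma rnormX x n : rnorm (x ^+ n) <= rnorm x ^+ n.
Proof.
elim: n => [|n IH]; first by rewrite !expr0 rnorm1.
rewrite !exprS (le_trans (rnormM _ _)) // ler_wpM2l //; exact: rnorm_ge0.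
Qed.

Lemma exprn_small (r e : R) : 0 <= r < 1 -> 0 < e -> exists n, r ^+ n < e.
Proof.
move=> /andP [r0 r1] e0; have r1' : `|r| < 1 by rewrite ger0_norm.
have /cvgrPdist_lt /(_ e e0) [n _ /(_ n (leqnn n))] := cvg_expr r1'.
rewrite sub0r normrN ger0_norm ?exprn_ge0 //.
by exists n.
Qed.

Lemma rnorm_eq x y : (forall e : R, 0 < e -> rnorm (x - y) < e) -> x = y.
Proof.
move=> h; apply/subr0_eq/rnorm0_eq0/eqP; rewrite eq_le rnorm_ge0 andbT.
by apply/ler_addgt0Pr => e /h; rewrite add0r => /ltW.
Qed.

Lemma ball_rnorm x (e : R) y : ball x e%:C y <-> rnorm (x - y) < e.
Proof. by rewrite -ball_normE /= normE ltcR. Qed.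

Lemma pos_complexE (e : R[i]) : 0 < e -> exists2 r : R, 0 < r & e = r%:C.
Proof.
move=> e0; exists (complex.Re e); last by rewrite RRe_real ?gtr0_real.
by rewrite -ltcR RRe_real ?gtr0_real.
Qed.

Lemma closed_rnormP (B : set A) : closed B <->
  forall x, (forall e : R, 0 < e -> exists2 y, B y & rnorm (x - y) < e) -> B x.
Proof.
split=> [cB x h|h x cx].
  apply: cB => U /nbhs_ballP [_/= /pos_complexE [e e0 ->] eU].
  have [y By xy] := h _ e0; exists y; split=> //.
  by apply: eU; apply/ball_rnorm.
apply: h => e e0.
have /cx [y [By /ball_rnorm xy]] : nbhs x (ball x e%:C).
  by apply/nbhs_ballP; exists e%:C => //=; rewrite ltcR.
by exists y.
Qed.

Lemma dense_rnorm (S : set A) : dense S ->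
  forall x (e : R), 0 < e -> exists2 y, S y & rnorm (x - y) < e.
Proof.
move=> dS x e e0.
have nx : nbhs x (ball x e%:C).
  by apply/nbhs_ballP; exists e%:C => //=; rewrite ltcR.
have [] := dS (ball x e%:C)°; first by exists x.
  exact: open_interior.
by move=> y [/interior_subset /ball_rnorm xy Sy]; exists y.
Qed.

Lemma rnorm_cauchy_lim (u : nat -> A) (e : nat -> R) :
  (forall n m, (n <= m)%N -> rnorm (u m - u n) <= e n) ->
  (forall d, 0 < d -> exists n, e n < d) ->
  exists l, forall n, rnorm (l - u n) <= e n.
Proof.
move=> ue e0.
have /cvg_ex [/= l ul] : cvg (u @ \oo).
  apply/cauchy_cvgP/cauchy_ballP => _ /pos_complexE [d d0 ->].
  have [n nd] := e0 _ (divr_gt0 d0 (ltr0Sn R 1)).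
  near=> x y => /=; apply/ball_rnorm.
  have xn : rnorm (x - u n) <= e n.
    near: x; exists n => // m /= nm; exact: ue.
  have yn : rnorm (y - u n) <= e n.
    near: y; exists n => // m /= nm; exact: ue.
  rewrite (le_lt_trans (rnormD3 x (u n) y)) // [rnorm (u n - _)]rnormB.
  by lra.
exists l => n; apply/ler_addgt0Pr => d d0.
have /(_ _)/= := ul (ball l d%:C); case.
  by apply/nbhs_ballP; exists d%:C => //=; rewrite ltcR.
move=> N _ NU.
have /ball_rnorm lt := NU (maxn n N) (leq_maxr _ _).
have := ue n (maxn n N) (leq_maxl _ _).
have := rnormD3 l (u (maxn n N)) (u n).
by lra.
Unshelve. all: by end_near.
Qed.

End RealNorm.

(** * Generated subalgebras and their stability *)
Section Subalgebras.
Variables (R : realType) (A : cstarAlgType R).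
Implicit Types (x y : A) (S C : set A).

Lemma cstar_subalgebraD C x y : cstar_subalgebra C -> C x -> C y -> C (x + y).
Proof. by move=> hC Cx Cy; rewrite -[x]scale1r; exact: (cstar_sub_linear hC). Qed.

Lemma cstar_subalgebraZ C c x : cstar_subalgebra C -> C x -> C (c *: x).
Proof.
move=> hC Cx; rewrite -[c *: x]addr0; apply: (cstar_sub_linear hC) => //.
exact: cstar_sub0 hC.
Qed.

Lemma cstar_subalgebraN C x : cstar_subalgebra C -> C x -> C (- x).
Proof. by move=> hC Cx; rewrite -scaleN1r; exact: cstar_subalgebraZ. Qed.

Lemma cstar_subalgebraB C x y : cstar_subalgebra C -> C x -> C y -> C (x - y).
Proof.
by move=> hC Cx Cy; apply: cstar_subalgebraD => //; exact: cstar_subalgebraN.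
Qed.

Lemma cstar_generated_subalgebra S : cstar_subalgebra (cstar_generated S).
Proof.
split.
- apply/closed_rnormP => x h B SB.
  apply: (iffLR (closed_rnormP B) (cstar_sub_closed (proj1 SB))) => e /h [y hy].
  by exists y => //; exact: hy.
- by move=> B [hB _]; exact: cstar_sub0 hB.
- by move=> c x y hx hy B SB; apply: (cstar_sub_linear (proj1 SB));
    [exact: hx|exact: hy].
- by move=> x y hx hy B SB; apply: (cstar_sub_mul (proj1 SB));
    [exact: hx|exact: hy].
- by move=> x hx B SB; apply: (cstar_sub_star (proj1 SB)); exact: hx.
Qed.

Definition unital_subalgebra C : Prop := cstar_subalgebra C /\ C 1.

Definition unital_hull S : set A := cstar_generated (1 |` S).

Lemma unital_hullP S : unital_subalgebra (unital_hull S).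
Proof.
split; first exact: cstar_generated_subalgebra.
by apply: sub_gen_smallest; left.
Qed.

Lemma sub_unital_hull S : S `<=` unital_hull S.
Proof. by move=> x Sx; apply: sub_gen_smallest; right. Qed.

Lemma unital_hull_min S C :
  unital_subalgebra C -> S `<=` C -> unital_hull S `<=` C.
Proof. by move=> [hC C1] SC; apply: smallest_sub => // x [->|/SC]. Qed.

Lemma unital_hullS S S' : S `<=` S' -> unital_hull S `<=` unital_hull S'.
Proof.
move=> SS'; apply: unital_hull_min; first exact: unital_hullP.
by apply: subset_trans SS' _; exact: sub_unital_hull.
Qed.

Lemma mul_approx x y (e : R) : 0 < e ->
  exists2 r : R, 0 < r & forall x' y', rnorm (x - x') < r ->
    rnorm (y - y') < r -> rnorm (x * y - x' * y') < e.
Proof.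
move=> e0; pose M := rnorm x + rnorm y + 1.
have x0 := rnorm_ge0 x; have y0 := rnorm_ge0 y.
have M0 : 0 < M by rewrite /M; lra.
exists (Num.min 1 (e / (2 * M))).
  by rewrite lt_min ltr01 divr_gt0 // mulr_gt0.
move=> x' y'; rewrite !lt_min !ltr_pdivlMr ?mulr_gt0 //.
move=> /andP [x1 xe] /andP [y1 ye].
have -> : x * y - x' * y' = (x - x') * y + x' * (y - y').
  by rewrite mulrBl mulrBr addrA subrK.
have nx' : rnorm x' <= M.
  have := rnormD (x' - x) x; rewrite subrK rnormB /M; lra.
have ny : rnorm y <= M by rewrite /M; lra.
apply: (le_lt_trans (rnormD _ _)).
have := rnormM (x - x') y; have := ler_wpM2l (rnorm_ge0 (x - x')) ny.
have := rnormM x' (y - y'); have := ler_wpM2r (rnorm_ge0 (y - y')) nx'.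
by lra.
Qed.

Lemma linear_approx c x y (e : R) : 0 < e ->
  exists2 r : R, 0 < r & forall x' y', rnorm (x - x') < r ->
    rnorm (y - y') < r -> rnorm (c *: x + y - (c *: x' + y')) < e.
Proof.
move=> e0; have c0 : 0 <= complex.Re `|c|.
  by rewrite -lecR RRe_real ?normr_ge0 // normr_real.
set k := complex.Re `|c| in c0.
have k1 : 0 < k + 1 by lra.
exists (e / (k + 1)); first by rewrite divr_gt0.
move=> x' y'; rewrite !ltr_pdivlMr // => xe ye.
rewrite opprD addrACA -scalerBr.
apply: (le_lt_trans (rnormD _ _)); rewrite rnormZ -/k.
have := rnorm_ge0 (x - x'); have := rnorm_ge0 (y - y').
move: (rnorm (x - x')) (rnorm (y - y')) xe ye => u v xe ye v0 u0.
nra.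
Qed.

(** Transports membership in a generated algebra by induction over the
generation, without naming polynomials in the generators. Perturbing the
generators and keeping only finitely many of them are both limits along a filter
on an index set of subalgebras. *)
Lemma approximable_subalgebra (I : Type) (F : set_system I) (C : I -> set A) :
  Filter F -> (forall i, unital_subalgebra (C i)) ->
  unital_subalgebra [set x | forall e : R, 0 < e ->
    F [set i | exists2 x', C i x' & rnorm (x - x') < e]].
Proof.
move=> FF hC; split; [split|].
- apply/closed_rnormP => x h e e0; have e2 : 0 < e / 2 by rewrite divr_gt0.
  have [y hy xy] := h _ e2.
  apply: filterS (hy _ e2) => i [y' Cy' yy']; exists y' => //.
  by rewrite (le_lt_trans (rnormD3 x y y')) //; lra.
- move=> e e0; apply: filterE => i; exists 0; last by rewrite subrr rnorm0.
  exact: cstar_sub0 (hC i).1.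
- move=> c x y hx hy e /(linear_approx c x y) [r r0 h].
  apply: filterS (filterI (hx _ r0) (hy _ r0)) => i [[x' Cx xx'] [y' Cy yy']].
  exists (c *: x' + y'); last exact: h.
  exact: (cstar_sub_linear (hC i).1).
- move=> x y hx hy e /(mul_approx x y) [r r0 h].
  apply: filterS (filterI (hx _ r0) (hy _ r0)) => i [[x' Cx xx'] [y' Cy yy']].
  exists (x' * y'); last exact: h.
  exact: (cstar_sub_mul (hC i).1).
- move=> x hx e e0; apply: filterS (hx _ e0) => i [x' Cx xx'].
  exists (star x'); first exact: (cstar_sub_star (hC i).1).
  by rewrite -starB rnorm_star.
- move=> e e0; apply: filterE => i; exists 1; last by rewrite subrr rnorm0.
  exact: (hC i).2.
Qed.

(** One-sided on purpose: the second set may contain unrelated elements, and each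
member of the first one is free to choose its approximation. *)
Definition approximates (r : R) S S' : Prop :=
  forall s, S s -> exists2 s', S' s' & rnorm (s - s') < r.

Lemma unital_hull_stable S x (e : R) : unital_hull S x -> 0 < e ->
  exists2 r : R, 0 < r & forall S', approximates r S S' ->
    exists2 x', unital_hull S' x' & rnorm (x - x') < e.
Proof.
pose F : set_system (set A) := [set P | exists2 r : R, 0 < r &
  forall S', approximates r S S' -> P S'].
have FF : Filter F.
  split=> [|P Q [r r0 hP] [s s0 hQ]|P Q PQ [r r0 hP]]; first by exists 1.
    exists (Num.min r s); first by rewrite lt_min r0.
    move=> S' h; split; [apply: hP|apply: hQ] => u /h [s' S's'];
    by rewrite lt_min => /andP [? ?]; exists s'.
  by exists r => // S' /hP /PQ.
move=> hx e0; have hY := approximable_subalgebra FF (@unital_hullP).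
have [s Ss d d0|r r0 h] := unital_hull_min hY _ hx _ e0; last by exists r.
exists d => // S' /(_ s Ss) [s' S's' ss'].
by exists s' => //; exact: sub_unital_hull.
Qed.

Lemma unital_hull_finite T S x (e : R) : unital_hull (T `|` S) x -> 0 < e ->
  exists2 l : seq A, (forall s, s \in l -> S s) &
    exists2 x', unital_hull (T `|` [set` l]) x' & rnorm (x - x') < e.
Proof.
pose F : set_system (seq A) := [set P | exists2 l : seq A,
  (forall s, s \in l -> S s) & forall l' : seq A, {subset l <= l'} -> P l'].
have FF : Filter F.
  split=> [|P Q [l lS hP] [k kS hQ]|P Q PQ [l lS hP]]; first by exists [::].
    exists (l ++ k); first by move=> s; rewrite mem_cat => /orP [/lS|/kS].
    by move=> l' h; split; [apply: hP|apply: hQ] => s sl; apply: h;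
      rewrite mem_cat sl ?orbT.
  by exists l => // l' /hP /PQ.
move=> hx e0.
have hY := approximable_subalgebra FF (fun l => unital_hullP (T `|` [set` l])).
have [|l lS h] := unital_hull_min hY _ hx _ e0.
  move=> s [Ts|Ss] d d0.
    exists [::] => // l _; exists s; last by rewrite subrr rnorm0.
    by apply: sub_unital_hull; left.
  exists [:: s] => [u|l sl]; first by rewrite inE => /eqP ->.
  exists s; last by rewrite subrr rnorm0.
  by apply: sub_unital_hull; right; apply: sl; rewrite inE.
by exists l => //; apply: h.
Qed.

End Subalgebras.

(** * Projections and corners *)
Section Projections.
Variables (R : realType) (A : cstarAlgType R).
Implicit Types (p q h x y : A) (C : set A).

Definition projection p : Prop := p * p = p /\ star p = p.

Definition corner q : set A := [set x | q * x = x /\ x * q = x].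

Lemma corner_sandwich q x : projection q -> corner q (q * x * q).
Proof. by move=> [qq _]; split; rewrite ?mulrA ?qq // -mulrA qq. Qed.

Lemma cornerM q x y : corner q x -> corner q y -> corner q (x * y).
Proof. by move=> [qx xq] [qy yq]; split; rewrite ?mulrA ?qx // -mulrA yq. Qed.

Lemma cornerB q x y : corner q x -> corner q y -> corner q (x - y).
Proof. by move=> [qx xq] [qy yq]; split; rewrite ?mulrBr ?mulrBl ?qx ?qy ?xq ?yq. Qed.

Lemma cornerD q x y : corner q x -> corner q y -> corner q (x + y).
Proof. by move=> [qx xq] [qy yq]; split; rewrite ?mulrDr ?mulrDl ?qx ?qy ?xq ?yq. Qed.

Lemma cornerZ q c x : corner q x -> corner q (c *: x).
Proof. by move=> [qx xq]; split; rewrite -?scalerAr -?scalerAl ?qx ?xq. Qed.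

Lemma corner_id q : projection q -> corner q q.
Proof. by move=> [qq _]. Qed.

Lemma closed_corner q : closed (corner q).
Proof.
apply/closed_rnormP => x h.
split; apply: rnorm_eq => e e0.
- have [r r0 hr] := mul_approx q x (divr_gt0 e0 (ltr0Sn R 1)).
  have := h (Num.min r (e / 2)); rewrite lt_min r0 divr_gt0 // => /(_ isT).
  move=> [y [qy yq]]; rewrite lt_min => /andP [xr xe].
  have := hr q y; rewrite subrr rnorm0 r0 qy => /(_ isT xr).
  have := rnormD3 (q * x) y x; rewrite [rnorm (y - x)]rnormB; lra.
- have [r r0 hr] := mul_approx x q (divr_gt0 e0 (ltr0Sn R 1)).
  have := h (Num.min r (e / 2)); rewrite lt_min r0 divr_gt0 // => /(_ isT).
  move=> [y [qy yq]]; rewrite lt_min => /andP [xr xe].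
  have := hr y q xr; rewrite subrr rnorm0 r0 yq => /(_ isT).
  have := rnormD3 (x * q) y x; rewrite [rnorm (y - x)]rnormB; lra.
Qed.

Lemma rnorm_projection p : projection p -> rnorm p <= 1.
Proof.
move=> [pp ps]; have := rnorm_star2 p; rewrite ps pp => h.
have := rnorm_ge0 p; move: (rnorm p) h => r h r0.
have [//|r1] := leP r 1; have := mulr_gt0 (lt_trans ltr01 r1) (lt_trans ltr01 r1).
nra.
Qed.

Lemma rnorm_partial_isometry x : x * star x * x = x -> rnorm x <= 1.
Proof.
move=> xx; have pP : projection (star x * x).
  by split; [rewrite -mulrA (mulrA x) xx|rewrite starM starK].
have := rnorm_projection pP; rewrite rnorm_star2 => h.
by rewrite -(@ler_pXn2r _ 2) ?nnegrE ?rnorm_ge0 // expr1n.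
Qed.

Definition smoothstep h : A := 3%:R * (h * h) - 2%:R * (h * h * h).

Lemma smoothstep_sub h :
  smoothstep h - h = (h * h - h) * (1 - 2%:R * h).
Proof.
pose phi : {rmorphism {poly R[i]} -> A} := horner_alg h.
have hX : h = phi 'X by rewrite /phi /= horner_algX.
have N n : n%:R = phi n%:R by rewrite rmorph_nat.
have N1 : 1 = phi 1 by rewrite rmorph1.
rewrite /smoothstep hX (N 3) (N 2) N1 -!(rmorphM phi, rmorphB phi).
by congr (phi _); ring.
Qed.

(** The defect is squared at each step, which drives the convergence below. *)
Lemma smoothstep_defect h :
  smoothstep h * smoothstep h - smoothstep h =
  (h * h - h) * (h * h - h) * (4%:R * (h * h - h) - 3%:R).
Proof.
pose phi : {rmorphism {poly R[i]} -> A} := horner_alg h.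
have hX : h = phi 'X by rewrite /phi /= horner_algX.
have N n : n%:R = phi n%:R by rewrite rmorph_nat.
rewrite /smoothstep hX (N 4) (N 3) (N 2) -!(rmorphM phi, rmorphB phi).
by congr (phi _); ring.
Qed.

Lemma rnorm_nat (n : nat) : rnorm (n%:R : A) <= n%:R.
Proof.
elim: n => [|n IH]; first by rewrite rnorm0.
rewrite -!natr1 (le_trans (rnormD _ _)) // rnorm1; lra.
Qed.

(** The cubic [3 h^2 - 2 h^3] has 0 and 1 as superattracting fixed points, so its
iterates carry an element with small defect [h^2 - h] to a projection; being
polynomials without constant term, they never leave a corner. *)
Lemma projection_near q h : projection q -> corner q h -> star h = h ->
  rnorm (h * h - h) <= 16^-1 ->
  exists p, [/\ projection p, corner q p &
    rnorm (p - h) <= 10 * rnorm (h * h - h)].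
Proof.
move=> qP hq hs; set t := rnorm (h * h - h) => t16.
have t0 : 0 <= t := rnorm_ge0 _.
pose u k := iter k smoothstep h.
have us k : star (u k) = u k.
  elim: k => //= k IH; rewrite /smoothstep starB !starM IH.
  have sn n : star (n%:R : A) = n%:R.
    by elim: n => [|n IHn]; rewrite ?star0 // -natr1 starD star1 IHn.
  by rewrite !sn !mulr_natl !mulr_natr !mulrA.
have uq k : corner q (u k).
  elim: k => //= k IH; rewrite /smoothstep !mulr_natl.
  rewrite -(scaler_nat 3 (_ * _)) -(scaler_nat 2 (_ * _ * _)).
  by apply: cornerB; apply: cornerZ;
    [exact: cornerM|exact: (cornerM (cornerM IH IH) IH)].
have ut k : rnorm (u k * u k - u k) <= t / 4 ^+ k.
  elim: k => [|k IH]; first by rewrite expr0 divr1.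
  rewrite /= smoothstep_defect.
  set d := u k * u k - u k in IH *.
  have d16 : rnorm d <= 16^-1.
    apply: le_trans IH (le_trans _ t16).
    by rewrite ler_pdivrMr ?exprn_gt0 // ler_peMr // exprn_ege1 // ler1n.
  have n4 : rnorm (4%:R * d - 3%:R) <= 4.
    have := rnormD (4%:R * d) (- 3%:R); rewrite rnormN.
    have := rnormM 4%:R d; have := rnorm_nat 4; have := rnorm_nat 3.
    have := rnorm_ge0 d; have := rnorm_ge0 (4%:R : A).
    nra.
  have := rnormM (d * d) (4%:R * d - 3%:R).
  have := rnormM d d.
  have -> : t / 4 ^+ k.+1 = t / 4 ^+ k / 4 by rewrite exprSr invfM mulrA.
  have := rnorm_ge0 d; have := rnorm_ge0 (4%:R * d - 3%:R).
  have := rnorm_ge0 (d * d).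
  nra.
have un k : rnorm (u k) <= 2.
  have := ut k; have := rnorm_star2 (u k); rewrite us => sq.
  have le16 : t / 4 ^+ k <= 16^-1.
    apply: le_trans _ t16.
    by rewrite ler_pdivrMr ?exprn_gt0 // ler_peMr // exprn_ege1 // ler1n.
  have := rnormD (u k * u k - u k) (u k); rewrite subrK sq.
  have := rnorm_ge0 (u k); nra.
have ud k : rnorm (u k.+1 - u k) <= 5 * (t / 4 ^+ k).
  rewrite /= smoothstep_sub (le_trans (rnormM _ _)) // mulrC.
  apply: ler_pM => //; try exact: rnorm_ge0.
  have := rnormD 1 (- (2%:R * u k)); rewrite rnormN rnorm1.
  have := rnormM 2%:R (u k); have := rnorm_nat 2; have := un k.
  have := rnorm_ge0 (2%:R : A); have := rnorm_ge0 (u k); nra.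
pose e k := 10 * (t / 4 ^+ k).
have ee k m : rnorm (u (k + m)%N - u k) <= e k - e (k + m)%N.
  elim: m => [|m IH]; first by rewrite addn0 !subrr rnorm0.
  rewrite addnS; apply: le_trans (rnormD3 _ (u (k + m)%N) _) _.
  have := ud (k + m)%N; rewrite /e.
  have -> : t / 4 ^+ (k + m).+1 = t / 4 ^+ (k + m) / 4 by rewrite exprSr invfM mulrA.
  have : 0 <= t / 4 ^+ (k + m) by rewrite divr_ge0 // exprn_ge0.
  rewrite /e in IH; lra.
have e_small d : 0 < d -> exists n, e n < d.
  move=> d0; have t1 : 0 < 10 * (t + 1) by lra.
  have [] := @exprn_small R 4^-1 (d / (10 * (t + 1))); first by apply/andP; split; lra.
    by rewrite divr_gt0.
  move=> n; rewrite ltr_pdivlMr // => nd; exists n; rewrite /e -exprVn.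
  apply: le_lt_trans _ nd; have : 0 <= (4^-1 : R) ^+ n by rewrite exprn_ge0.
  nra.
have [||p pe] := @rnorm_cauchy_lim _ _ u e.
- move=> n m /subnKC <-; apply: le_trans (ee _ _) _.
  have : 0 <= e (n + (m - n))%N by rewrite /e mulr_ge0 // divr_ge0 // exprn_ge0.
  lra.
- by move=> d; exact: e_small.
have pu d : 0 < d -> exists2 n, rnorm (p - u n) < d & t / 4 ^+ n < d.
  move=> d0; have [n] := e_small d d0; rewrite /e => ed; exists n.
    exact: le_lt_trans (pe n) ed.
  have : 0 <= t / 4 ^+ n by rewrite divr_ge0 // exprn_ge0.
  lra.
exists p; split; last by have := pe 0; rewrite /e expr0 divr1.
- split; apply: rnorm_eq => d d0.
    have d3 : 0 < d / 3 by rewrite divr_gt0.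
    have [r r0 hr] := mul_approx p p d3.
    have [] := pu (Num.min r (d / 3)); first by rewrite lt_min r0.
    move=> n; rewrite !lt_min => /andP [nr nd] /andP [_ td].
    have := rnormD3 (p * p) (u n * u n) p; have := hr _ _ nr nr.
    have := rnormD3 (u n * u n) (u n) p; have := ut n.
    rewrite [rnorm (u n - p)]rnormB; lra.
  have [n nd _] := pu _ (divr_gt0 d0 (ltr0Sn R 1)).
  apply: le_lt_trans (rnormD3 _ (u n) _) _.
  rewrite -{1}(us n) -starB rnorm_star [rnorm (u n - p)]rnormB; lra.
- apply: (iffLR (closed_rnormP _) (@closed_corner q)) => d /pu [n nd _].
  by exists (u n).
Qed.

(** Powers kill the contraction [y] and leave the orthogonal projection [r]. *)
Lemma projection_of_power C r y : unital_subalgebra C -> r * r = r ->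
  r * y = 0 -> y * r = 0 -> rnorm y < 1 -> C (r + y) -> C r.
Proof.
move=> [hC C1] rr ry yr y1 Cry.
have CX n : C ((r + y) ^+ n).
  elim: n => [|n IH]; first by rewrite expr0.
  by rewrite exprS; exact: (cstar_sub_mul hC).
have XE n : (r + y) ^+ n.+1 = r + y ^+ n.+1.
  elim: n => [|n IH]; first by rewrite !expr1.
  rewrite exprS IH mulrDl !mulrDr rr -exprS [y ^+ n.+1]exprS mulrA ry yr.
  by rewrite mul0r addr0 add0r.
apply: (iffLR (closed_rnormP _) (cstar_sub_closed hC)) => e e0.
have [n ne] := exprn_small (introT andP (conj (rnorm_ge0 y) y1)) e0.
exists ((r + y) ^+ n.+1) => //; rewrite XE opprD addrA subrr sub0r rnormN.
apply: le_lt_trans (rnormX y n.+1) (le_lt_trans _ ne).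
by rewrite exprS ler_piMl ?exprn_ge0 ?rnorm_ge0 // ltW.
Qed.

(** The elements [1 - y ^+ n] all lie in [C] and tend to [1]. *)
Lemma unit_of_contraction C y : cstar_subalgebra C -> rnorm y < 1 ->
  C (1 - y) -> C 1.
Proof.
move=> hC y1 Cy.
have CX n : C (1 - y ^+ n).
  elim: n => [|n IH]; first by rewrite expr0 subrr; exact: cstar_sub0 hC.
  have -> : 1 - y ^+ n.+1 = (1 - y ^+ n) + (1 - y) - (1 - y ^+ n) * (1 - y).
    rewrite mulrBr mulr1 opprB [RHS]addrC addrA subrK mulrBl mul1r -exprSr.
    by rewrite [RHS]addrC addrA subrK.
  apply: cstar_subalgebraB => //; first exact: cstar_subalgebraD.
  exact: (cstar_sub_mul hC).
apply: (iffLR (closed_rnormP _) (cstar_sub_closed hC)) => e e0.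
have [n ne] := exprn_small (introT andP (conj (rnorm_ge0 y) y1)) e0.
exists (1 - y ^+ n) => //; rewrite opprB addrC subrK.
exact: le_lt_trans (rnormX y n) ne.
Qed.

(** A closed subspace that comes within half the norm of every element of the
corner contains the corner: correct the error repeatedly. *)
Lemma corner_sub_of_half C q : cstar_subalgebra C ->
  (forall g, corner q g -> exists2 c, C c &
     corner q (g - c) /\ rnorm (g - c) <= rnorm g / 2) ->
  corner q `<=` C.
Proof.
move=> hC half g qg.
have approx n : exists2 c, C c & corner q (g - c) /\ rnorm (g - c) <= rnorm g * 2^-1 ^+ n.
  elim: n => [|n [c Cc [qc gc]]].
    by exists 0; [exact: cstar_sub0 hC|rewrite subr0 expr0 mulr1].
  have [c' Cc' [qc' gc']] := half _ qc.
  exists (c + c'); first exact: cstar_subalgebraD.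
  rewrite opprD addrA; split=> //; apply: le_trans gc' _.
  by rewrite exprSr mulrA ler_pM2r ?invr_gt0.
apply: (iffLR (closed_rnormP _) (cstar_sub_closed hC)) => e e0.
have g1 : 0 < rnorm g + 1 by have := rnorm_ge0 g; lra.
have [] := @exprn_small R 2^-1 (e / (rnorm g + 1)); first by apply/andP; split; lra.
  by rewrite divr_gt0.
move=> n; rewrite ltr_pdivlMr // => ne.
have [c Cc [_ gc]] := approx n; exists c => //.
apply: le_lt_trans gc (le_lt_trans _ ne).
rewrite mulrC; apply: ler_wpM2l; first by rewrite exprn_ge0.
by lra.
Qed.

End Projections.

(** * Partial permutation matrices splitting the unit *)
Section RelationMatrices.
Variables (R : realType) (n : nat).
Implicit Types e f : nat -> nat -> bool.

Definition rel_mx e : 'M[R[i]]_n := \matrix_(i, j) (e i j)%:R.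

Lemma eq_rel_mx e f : (forall i j, (i < n)%N -> (j < n)%N -> e i j = f i j) ->
  rel_mx e = rel_mx f.
Proof. by move=> ef; apply/matrixP => i j; rewrite !mxE ef. Qed.

Lemma rel_mx_adjoint e : (rel_mx e)^t* = rel_mx (fun i j => e j i).
Proof. by apply/matrixP => i j; rewrite !mxE rmorph_nat. Qed.

(** The function [m] names the only index that can contribute to the sum defining
an entry of the product. *)
Lemma mul_rel_mx e f (m : nat -> nat -> nat) :
  (forall i l j, (i < n)%N -> (l < n)%N -> (j < n)%N ->
     e i l -> f l j -> l = m i j) ->
  rel_mx e *m rel_mx f =
  rel_mx (fun i j => [&& (m i j < n)%N, e i (m i j) & f (m i j) j]).
Proof.
move=> mP; apply/matrixP => i j; rewrite !mxE.
have zero (l : 'I_n) : l != m i j :> nat -> rel_mx e i l * rel_mx f l j = 0.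
  move=> lm; rewrite !mxE -natrM mulnb; case: andP => // -[eil flj].
  by move: lm; rewrite (mP i l j) ?eqxx.
have [mn|mn] := ltnP (m i j) n; last first.
  rewrite big1 // => l _; apply: zero; apply/eqP => lm.
  by move: (ltn_ord l); rewrite lm ltnNge mn.
rewrite (bigD1 (Ordinal mn)) //= big1 ?addr0.
  by rewrite !mxE -natrM mulnb.
by move=> l; rewrite -val_eqE /= => lm; exact: zero.
Qed.

End RelationMatrices.

Section SplittingMatrices.
Variables (R : realType) (n : nat).
Hypothesis n_gt1 : (1 < n)%N.

Let a := n./2.

(** With [a] half of the size, [shift_mx] carries the second block of [a] indices
onto the first one, and [tail_mx] carries the index [a + a], present when the
size is odd, into the second block. *)
Definition shift_mx : 'M[R[i]]_n :=
  rel_mx R n (fun i j => (i < a)%N && (j == i + a)%N).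
Definition tail_mx : 'M[R[i]]_n :=
  rel_mx R n (fun i j => (i == a)%N && (j == a + a)%N).

Let halves : [/\ (0 < a)%N, (a + a <= n)%N & (n <= a + a + 1)%N].
Proof. by rewrite /a; split; lia. Qed.

Lemma shift_mx_sq : shift_mx *m shift_mx = 0.
Proof.
case: halves => a0 an na.
rewrite (@mul_rel_mx R n _ _ (fun i j => i + a)%N); last by lia.
apply/matrixP => i j; rewrite !mxE; case: and3P => // -[]; lia.
Qed.

Lemma shift_mx_range : shift_mx *m shift_mx^t* =
  rel_mx R n (fun i j => (i == j) && (i < a)%N).
Proof.
case: halves => a0 an na; rewrite rel_mx_adjoint.
rewrite (@mul_rel_mx R n _ _ (fun i j => i + a)%N); last by lia.
by apply: eq_rel_mx => i j; lia.
Qed.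

Lemma shift_mx_source : shift_mx^t* *m shift_mx =
  rel_mx R n (fun i j => [&& i == j, a <= i & i < a + a]%N).
Proof.
case: halves => a0 an na; rewrite rel_mx_adjoint.
rewrite (@mul_rel_mx R n _ _ (fun i j => i - a)%N); last by lia.
by apply: eq_rel_mx => i j; lia.
Qed.

Lemma tail_mx_source : tail_mx^t* *m tail_mx =
  rel_mx R n (fun i j => (i == j) && (i == a + a)%N).
Proof.
case: halves => a0 an na; rewrite rel_mx_adjoint.
rewrite (@mul_rel_mx R n _ _ (fun i j => a)%N); last by lia.
by apply: eq_rel_mx => i j; lia.
Qed.

Lemma shift_mx_partial : shift_mx *m shift_mx^t* *m shift_mx = shift_mx.
Proof.
case: halves => a0 an na; rewrite shift_mx_range.
rewrite (@mul_rel_mx R n _ _ (fun i j => i)); last by lia.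
by apply: eq_rel_mx => i j; lia.
Qed.

Lemma tail_shift_mx : tail_mx *m shift_mx = 0.
Proof.
case: halves => a0 an na.
rewrite (@mul_rel_mx R n _ _ (fun i j => i + i)%N); last by lia.
apply/matrixP => i j; rewrite !mxE; case: and3P => // -[]; lia.
Qed.

Lemma tail_shift_adjoint_mx : tail_mx *m shift_mx^t* = 0.
Proof.
case: halves => a0 an na; rewrite rel_mx_adjoint.
rewrite (@mul_rel_mx R n _ _ (fun i j => i + i)%N); last by lia.
apply/matrixP => i j; rewrite !mxE; case: and3P => // -[]; lia.
Qed.

Lemma shift_source_tail_mx : shift_mx^t* *m shift_mx *m tail_mx = tail_mx.
Proof.
case: halves => a0 an na; rewrite shift_mx_source.
rewrite (@mul_rel_mx R n _ _ (fun i j => i)); last by lia.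
by apply: eq_rel_mx => i j; lia.
Qed.

Lemma shift_tail_unit : shift_mx *m shift_mx^t* + shift_mx^t* *m shift_mx +
  tail_mx^t* *m tail_mx = 1%:M.
Proof.
case: halves => a0 an na.
rewrite shift_mx_range shift_mx_source tail_mx_source.
apply/matrixP => i j; rewrite !mxE -!natrD -val_eqE /=; congr _%:R.
have := ltn_ord i; have := ltn_ord j; lia.
Qed.

End SplittingMatrices.

(** * Splitting pairs in approximately divisible algebras *)
Section SplittingPairs.
Variables (R : realType) (A : cstarAlgType R).
Implicit Types (x y w z : A) (B : set A).

(** [w * star w], [star w * w] and [star z * z] are three orthogonal projections
of sum 1; [w] carries the second onto the first, and [z] carries the third into
the second. *)
Record splitting_pair w z : Prop := SplittingPair {
  split_ww : w * w = 0;
  split_partial : w * star w * w = w;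
  split_zw : z * w = 0;
  split_zws : z * star w = 0;
  split_source_z : star w * w * z = z;
  split_unit : w * star w + star w * w + star z * z = 1
}.

Lemma bigminn_leq (I : eqType) (s : seq I) (m : nat) (k : I -> nat) i :
  i \in s -> (\big[minn/m]_(j <- s) k j <= k i)%N.
Proof.
elim: s => // j s IH; rewrite inE big_cons => /orP [/eqP ->|/IH].
  exact: geq_minl.
by apply: leq_trans; exact: geq_minr.
Qed.

Lemma subrank_blocks B (m : nat) : (0 < m)%N -> (m <= SubRank B)%N ->
  exists (r : nat) (k : 'I_r.+1 -> nat)
    (phi : (forall i : 'I_r.+1, 'M[R[i]]_(k i)) -> A),
    (forall i, m <= k i)%N /\ direct_sum_star_iso B phi.
Proof.
move=> m0; rewrite /SubRank; case: xgetP => [_ _ [r [k [[k0 [phi hphi]] ->]]] mk|_].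
  exists r, k, phi; split=> // i; apply: leq_trans mk _.
  by apply: bigminn_leq; exact: mem_index_enum.
by rewrite leqNgt m0.
Qed.

(** Each block is cut in two halves, with one index left over when its size is
odd. A left over index has to be attached to a half, so blocks of size 1 must be
excluded. *)
Lemma splitting_pair_in B : cstar_subalgebra B -> B 1 -> (1 < SubRank B)%N ->
  exists w z, [/\ splitting_pair w z, B w & B z].
Proof.
move=> hB B1 /(subrank_blocks (ltn0Sn 1)) [r [k [phi [k2 hphi]]]].
have onto x : B x -> exists f, phi f = x.
  by move=> Bx; have [_ _ /(_ x Bx) [f _ <-]] := dssi_bij hphi; exists f.
have phi_in f : B (phi f) by have [/(_ f I)] := dssi_bij hphi.
have phiM f g h : (forall i, f i *m g i = h i) -> phi f * phi g = phi h.
  move=> fgh; rewrite -(dssi_mul hphi); congr phi.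
  by apply: functional_extensionality_dep.
have phiD f g h : (forall i, f i + g i = h i) -> phi f + phi g = phi h.
  move=> fgh; rewrite -[phi f]scale1r -(dssi_linear hphi); congr phi.
  by apply: functional_extensionality_dep => i; rewrite scale1r fgh.
have phi0 : phi (fun i => 0) = 0.
  apply: (addrI (phi (fun i => 0))); rewrite addr0; apply: phiD => i.
  by rewrite addr0.
have phi1 : phi (fun i => 1%:M) = 1.
  have [f f1] := onto _ B1.
  by rewrite -[LHS]mulr1 -{1}f1 (phiM _ _ f) // => i; rewrite mul1mx.
pose W i := shift_mx R (k i); pose Z i := tail_mx R (k i).
have Ws : star (phi W) = phi (fun i => (W i)^t*) by rewrite -(dssi_star hphi).
have Zs : star (phi Z) = phi (fun i => (Z i)^t*) by rewrite -(dssi_star hphi).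
exists (phi W), (phi Z); split=> //; split; rewrite ?Ws ?Zs -?phi0 -?phi1.
- by apply: phiM => i; exact: shift_mx_sq.
- rewrite (phiM _ _ (fun i => W i *m (W i)^t*)) //.
  by apply: phiM => i; exact: shift_mx_partial.
- by apply: phiM => i; exact: tail_shift_mx.
- by apply: phiM => i; exact: tail_shift_adjoint_mx.
- rewrite (phiM _ _ (fun i => (W i)^t* *m W i)) //.
  by apply: phiM => i; exact: shift_source_tail_mx.
- rewrite (phiM _ _ (fun i => W i *m (W i)^t*)) //.
  rewrite (phiM _ _ (fun i => (W i)^t* *m W i)) //.
  rewrite (phiM _ _ (fun i => (Z i)^t* *m Z i)) //.
  rewrite (phiD _ _ (fun i => W i *m (W i)^t* + (W i)^t* *m W i)) //.
  by apply: phiD => i; exact: shift_tail_unit.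
Qed.

Section Relations.
Variables w z : A.
Hypothesis wz : splitting_pair w z.

Lemma split_partials : star w * w * star w = star w.
Proof. by rewrite -[in RHS](split_partial wz) !starM starK mulrA. Qed.

Lemma split_partial_z : z * star z * z = z.
Proof.
rewrite -[RHS]mulr1 -(split_unit wz) !mulrDr !mulrA (split_zw wz).
by rewrite (split_zws wz) !mul0r !add0r.
Qed.

Lemma split_wsws : star w * star w = 0.
Proof. by rewrite -starM (split_ww wz) star0. Qed.

Lemma split_wszs : star w * star z = 0.
Proof. by rewrite -starM (split_zw wz) star0. Qed.

Lemma split_wzs : w * star z = 0.
Proof. by rewrite -[w]starK -starM (split_zws wz) star0. Qed.

Lemma rnorm_split : rnorm w <= 1 /\ rnorm z <= 1.
Proof.
split; apply: rnorm_partial_isometry; first exact: (split_partial wz).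
exact: split_partial_z.
Qed.

End Relations.

Lemma almost_central_splitting (l : seq A) (e : R) :
  approximately_divisible A -> 0 < e ->
  exists w z, splitting_pair w z /\ forall x y, x \in l ->
    y \in [:: w; star w; z; star z] -> rnorm (x * y - y * x) < e.
Proof.
move=> hA e0.
have [B [hB _ B1 rB comm]] := hA _ (fun i : 'I_(size l) => l`_i) e e0.
have [w [z [wz Bw Bz]]] := splitting_pair_in hB B1 rB.
exists w, z; split=> // x y /(nthP 0) [i il <-] yl.
have [w1 z1] := rnorm_split wz.
have [By y1] : B y /\ rnorm y <= 1.
  move: yl; rewrite !inE => /or4P [] /eqP -> //; rewrite rnorm_star; split=> //;
  exact: (cstar_sub_star hB).
rewrite -ltcR -normE; apply: (comm (Ordinal il)) => //.
by rewrite normE lecR.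
Qed.

End SplittingPairs.

(** * Sequences up to vanishing errors *)
Section Asymptotics.
Variables (R : realType) (A : cstarAlgType R).
Implicit Types (x y w z p q : A) (u v : nat -> A).

Definition bounded u : Prop := exists K : R, forall n, rnorm (u n) <= K.

(** A rate of decay instead of a limit: errors are then combined by adding and
multiplying constants, without thresholds. *)
Definition vanishing u : Prop :=
  exists K : R, forall n, rnorm (u n) <= K / n.+1%:R.

Lemma bounded_const x : bounded (fun=> x).
Proof. by exists (rnorm x). Qed.

Lemma bounded_star u : bounded u -> bounded (fun n => star (u n)).
Proof. by move=> [K h]; exists K => n; rewrite rnorm_star. Qed.

Lemma boundedD u v : bounded u -> bounded v -> bounded (fun n => u n + v n).
Proof.
by move=> [K hK] [L hL]; exists (K + L) => n;
  rewrite (le_trans (rnormD _ _)) // lerD.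
Qed.

Lemma boundedN u : bounded u -> bounded (fun n => - u n).
Proof. by move=> [K h]; exists K => n; rewrite rnormN. Qed.

Lemma boundedM u v : bounded u -> bounded v -> bounded (fun n => u n * v n).
Proof.
move=> [K hK] [L hL]; exists (K * L) => n.
by rewrite (le_trans (rnormM _ _)) // ler_pM ?rnorm_ge0.
Qed.

Lemma eq_vanishing u v : (forall n, u n = v n) -> vanishing u -> vanishing v.
Proof. by move=> uv [K h]; exists K => n; rewrite -uv. Qed.

Lemma vanishing_star u : vanishing u -> vanishing (fun n => star (u n)).
Proof. by move=> [K h]; exists K => n; rewrite rnorm_star. Qed.

Lemma vanishing0 u : (forall n, u n = 0) -> vanishing u.
Proof. by move=> u0; exists 0 => n; rewrite u0 rnorm0 mul0r. Qed.

Lemma vanishingD u v :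
  vanishing u -> vanishing v -> vanishing (fun n => u n + v n).
Proof.
move=> [K hK] [L hL]; exists (K + L) => n.
by rewrite (le_trans (rnormD _ _)) // mulrDl lerD.
Qed.

Lemma vanishingN u : vanishing u -> vanishing (fun n => - u n).
Proof. by move=> [K h]; exists K => n; rewrite rnormN. Qed.

Lemma vanishingMl u v :
  bounded u -> vanishing v -> vanishing (fun n => u n * v n).
Proof.
move=> [K hK] [L hL]; exists (K * L) => n.
by rewrite (le_trans (rnormM _ _)) // -mulrA ler_pM ?rnorm_ge0.
Qed.

Lemma vanishingMr u v :
  vanishing u -> bounded v -> vanishing (fun n => u n * v n).
Proof.
move=> [K hK] [L hL]; exists (K * L) => n.
by rewrite (le_trans (rnormM _ _)) // mulrAC ler_pM ?rnorm_ge0.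
Qed.

Lemma vanishing_small u (e : R) : vanishing u -> 0 < e ->
  exists N, forall n, (N <= n)%N -> rnorm (u n) < e.
Proof.
move=> [K h] e0; have K0 : 0 <= `|K| / e by rewrite divr_ge0 // ltW.
exists (Num.Def.archi_bound (`|K| / e)) => n nN.
apply: le_lt_trans (h n) _; rewrite ltr_pdivrMr // mulrC.
apply: le_lt_trans (ler_norm K) _; rewrite -ltr_pdivrMr //.
apply: lt_le_trans (archi_boundP K0) _.
by rewrite ler_nat (leq_trans nN).
Qed.

Lemma vanishing_small_seq (T : eqType) (l : seq T) (u : T -> nat -> A) (e : R) :
  (forall i, i \in l -> vanishing (u i)) -> 0 < e ->
  exists N, forall i, i \in l -> forall n, (N <= n)%N -> rnorm (u i n) < e.
Proof.
move=> + e0; elim: l => [|i l IH] hl; first by exists 0%N.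
have [|N hN] := IH; first by move=> j jl; apply: hl; rewrite inE jl orbT.
have [M hM] := vanishing_small (hl i (mem_head _ _)) e0.
exists (maxn M N) => j; rewrite inE => /orP [/eqP ->|jl] n;
  rewrite geq_max => /andP [Mn Nn]; [exact: hM|exact: hN].
Qed.

Definition almost_commute x u : Prop := vanishing (fun n => x * u n - u n * x).

Lemma almost_commuteM x u v : bounded u -> bounded v ->
  almost_commute x u -> almost_commute x v ->
  almost_commute x (fun n => u n * v n).
Proof.
move=> bu bv xu xv.
apply: eq_vanishing (vanishingD (vanishingMr xu bv) (vanishingMl bu xv)) => n.
by rewrite mulrBl mulrBr !mulrA addrA subrK.
Qed.

Lemma almost_commuteD x u v : almost_commute x u -> almost_commute x v ->
  almost_commute x (fun n => u n + v n).
Proof.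
move=> xu xv; apply: eq_vanishing (vanishingD xu xv) => n.
by rewrite mulrDr mulrDl opprD addrACA.
Qed.

Lemma almost_commuteN x u :
  almost_commute x u -> almost_commute x (fun n => - u n).
Proof.
move=> xu; apply: eq_vanishing (vanishingN xu) => n.
by rewrite mulrN mulNr opprB opprK addrC.
Qed.

Lemma almost_commute_const x y :
  x * y = y * x -> almost_commute x (fun=> y).
Proof. by move=> xy; apply: vanishing0 => n; rewrite xy subrr. Qed.

Lemma almost_commute_star x u : star x = x -> almost_commute x u ->
  almost_commute x (fun n => star (u n)).
Proof.
move=> xs xu; apply: eq_vanishing (vanishingN (vanishing_star xu)) => n.
by rewrite starB !starM xs opprB.
Qed.

Definition conj_sum (v1 v2 v3 x : A) : A :=
  v1 * x * star v1 + v2 * x * star v2 + v3 * x * star v3.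

Section Compression.
Variable q : A.
Hypothesis qP : projection q.
Let qq : q * q = q := qP.1.
Let qs : star q = q := qP.2.

(** Compression to a corner is multiplicative on what commutes with [q]; here is
the asymptotic version, stated as a relation so that the compressed sequence may
itself be known up to a vanishing error. *)
Record compresses_to u v : Prop := CompressesTo {
  compress_bl : bounded u;
  compress_br : bounded v;
  compress_comm : almost_commute q v;
  compress_eq : vanishing (fun n => u n - q * v n * q)
}.

Lemma eq_compresses u v u' v' : (forall n, u n = u' n) ->
  (forall n, v n = v' n) -> compresses_to u v -> compresses_to u' v'.
Proof.
move=> uu' vv'; have -> : u' = u by apply/funext.
by have -> : v' = v by apply/funext.
Qed.

Lemma compresses_unit : compresses_to (fun=> q) (fun=> 1).
Proof.
split; [exact: bounded_const|exact: bounded_const| |].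
  by apply: almost_commute_const; rewrite mulr1 mul1r.
by apply: vanishing0 => n; rewrite mulr1 qq subrr.
Qed.

Lemma compresses_corner g : corner q g -> compresses_to (fun=> g) (fun=> g).
Proof.
move=> [qg gq]; split; [exact: bounded_const|exact: bounded_const| |].
  by apply: almost_commute_const; rewrite qg gq.
by apply: vanishing0 => n; rewrite qg gq subrr.
Qed.

Lemma compresses_star u v : compresses_to u v ->
  compresses_to (fun n => star (u n)) (fun n => star (v n)).
Proof.
move=> [bu bv cv e]; split; try exact: bounded_star.
  exact: almost_commute_star.
apply: eq_vanishing (vanishing_star e) => n.
by rewrite starB !starM qs mulrA.
Qed.

Lemma compressesD u v u' v' : compresses_to u v -> compresses_to u' v' ->
  compresses_to (fun n => u n + u' n) (fun n => v n + v' n).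
Proof.
move=> [bu bv cv e] [bu' bv' cv' e']; split; try exact: boundedD.
  exact: almost_commuteD.
apply: eq_vanishing (vanishingD e e') => n.
by rewrite mulrDr mulrDl opprD addrACA.
Qed.

Lemma compressesN u v : compresses_to u v ->
  compresses_to (fun n => - u n) (fun n => - v n).
Proof.
move=> [bu bv cv e]; split; try exact: boundedN.
  exact: almost_commuteN.
apply: eq_vanishing (vanishingN e) => n.
by rewrite mulrN mulNr opprB opprK addrC.
Qed.

Lemma compressesM u v u' v' : compresses_to u v -> compresses_to u' v' ->
  compresses_to (fun n => u n * u' n) (fun n => v n * v' n).
Proof.
move=> [bu bv cv e] [bu' bv' cv' e']; split; try exact: boundedM.
  exact: almost_commuteM.
have bq := bounded_const q.
have t1 := vanishingMr e bu'.
have t2 := vanishingMl (boundedM (boundedM bq bv) bq) e'.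
have t3 := vanishingMl bq (vanishingMr cv (boundedM bv' bq)).
apply: eq_vanishing (vanishingD (vanishingD t1 t2) (vanishingN t3)) => n.
rewrite !mulrBl !mulrBr !mulrA qq.
have qqv y : y * q * q = y * q by rewrite -mulrA qq.
by rewrite !qqv opprB !subrKA.
Qed.

Lemma compresses_conj_sum u1 u2 u3 u v1 v2 v3 v :
  compresses_to u1 v1 -> compresses_to u2 v2 -> compresses_to u3 v3 ->
  compresses_to u v ->
  compresses_to (fun n => conj_sum (u1 n) (u2 n) (u3 n) (u n))
    (fun n => conj_sum (v1 n) (v2 n) (v3 n) (v n)).
Proof.
move=> h1 h2 h3 h; apply: compressesD; first apply: compressesD;
by apply: compressesM; [exact: compressesM|exact: compresses_star].
Qed.

Lemma compresses_recover x u v : corner q x -> compresses_to u v ->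
  vanishing (fun n => x - v n) -> vanishing (fun n => x - u n).
Proof.
move=> [qx xq] [_ _ _ e] xv; have bq := bounded_const q.
have := vanishingD (vanishingMr (vanishingMl bq xv) bq) (vanishingN e).
apply: eq_vanishing => n.
by rewrite mulrBr mulrBl qx xq opprB addrA subrK.
Qed.

End Compression.

(** If the [u_i] commute with [x], then [x] factors out of the sum. *)
Lemma conj_sum_vanishing x (u1 u2 u3 : nat -> A) :
  bounded u1 -> bounded u2 -> bounded u3 ->
  almost_commute x u1 -> almost_commute x u2 -> almost_commute x u3 ->
  (forall n, u1 n * star (u1 n) + u2 n * star (u2 n) + u3 n * star (u3 n) = 1) ->
  vanishing (fun n => x - conj_sum (u1 n) (u2 n) (u3 n) x).
Proof.
move=> b1 b2 b3 c1 c2 c3 sum1.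
have t1 := vanishingMr c1 (bounded_star b1).
have t2 := vanishingMr c2 (bounded_star b2).
have t3 := vanishingMr c3 (bounded_star b3).
apply: eq_vanishing (vanishingD (vanishingD t1 t2) t3) => n.
pose S := u1 n * star (u1 n) + u2 n * star (u2 n) + u3 n * star (u3 n).
transitivity (x * S - conj_sum (u1 n) (u2 n) (u3 n) x); last first.
  by rewrite /S sum1 mulr1.
rewrite /conj_sum /S !mulrBl !mulrDr !mulrA.
by rewrite !opprD [RHS]addrACA; congr (_ + _); rewrite [RHS]addrACA.
Qed.

End Asymptotics.

(** * Encoding an element in a smaller corner *)
Section CornerEncoding.
Variables (R : realType) (A : cstarAlgType R).
Implicit Types (x y w z p q d g : A) (C : set A) (l : seq A).

Section Path.
Variables w z d : A.
Hypothesis wz : splitting_pair w z.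

Let ww := split_ww wz.
Let www := split_partial wz.
Let zw := split_zw wz.
Let zws := split_zws wz.
Let swz := split_source_z wz.
Let wsws := split_wsws wz.
Let wszs := split_wszs wz.
Let wzs := split_wzs wz.
Let wswws := split_partials wz.

(** In matrix terms, a path joining the three projections, with [d] placed on the
middle one: cutting with the first projection isolates [w], then [z] and the
compression of [d] become accessible through [w]. *)
Definition path_element : A :=
  w + star w + z + star z + star w * w * d * (star w * w).

Lemma split_wsz : star w * z = 0.
Proof. by rewrite -swz !mulrA wsws !mul0r. Qed.

Lemma split_zs_source : star z * (star w * w) = star z.
Proof. by rewrite -[in RHS]swz !starM starK mulrA. Qed.

Lemma path_element_left : star w * path_element = star w * w.
Proof.
by rewrite /path_element !mulrDr !mulrA wsws wszs split_wsz !mul0r !addr0.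
Qed.

Lemma path_element_range : w * star w * path_element = w.
Proof. by rewrite -mulrA path_element_left mulrA www. Qed.

Lemma path_element_range0 :
  w * star w * path_element * (w * star w) = 0.
Proof. by rewrite path_element_range mulrA ww mul0r. Qed.

Lemma path_element_right : path_element * star w =
  w * star w + star z * star w + star w * w * d * star w.
Proof.
rewrite /path_element !mulrDl wsws zws !addr0; congr (_ + _).
by rewrite -[_ * _ * star w]mulrA wswws.
Qed.

Lemma path_element_w : w * path_element * star w = w * d * star w.
Proof.
rewrite -mulrA path_element_right !mulrDr !mulrA ww wzs !mul0r !add0r.
by rewrite www.
Qed.

Lemma path_element_z : star z * z * path_element * star w = star z * star w.
Proof.
rewrite -mulrA path_element_right !mulrDr !mulrA.
have zss : star z * z * star z = star z.
  by rewrite -[in RHS](split_partial_z wz) !starM starK mulrA.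
rewrite zss -(mulrA (star z) z) zw -(mulrA (star z) z) zws.
by rewrite !mulr0 !mul0r addr0 add0r.
Qed.

Lemma split_frame : w * star w * star (w * star w) + star w * star (star w) +
  star z * star w * star (star z * star w) = 1.
Proof.
rewrite !starM !starK -[RHS](split_unit wz) !mulrA www; congr (_ + _).
by rewrite -!mulrA (mulrA (star w)) swz.
Qed.

Lemma split_frame_w : w * star w + star w * w * star (star w * w) +
  star z * star (star z) = 1.
Proof.
by rewrite starM !starK -[RHS](split_unit wz) !mulrA wswws.
Qed.

(** Carried by [w] to the first projection and spread back over the three of them,
the encoded piece of [d] is a sum of conjugates of [d] by partial isometries. *)
Lemma conj_sum_split_w :
  conj_sum (w * star w) (star w) (star z * star w) (w * d * star w) =
  conj_sum w (star w * w) (star z) d.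
Proof.
rewrite /conj_sum !starM !starK.
have -> : w * star w * (w * d * star w) * (w * star w) = w * d * star w.
  by rewrite !mulrA www -(mulrA _ (star w) w) -(mulrA _ (star w * w)) wswws.
have -> : star w * (w * d * star w) * w = star w * w * d * (star w * w).
  by rewrite !mulrA.
have -> : star z * star w * (w * d * star w) * (w * z) = star z * d * z.
  rewrite -[in RHS]split_zs_source !mulrA.
  rewrite -(mulrA _ (star w) w) -(mulrA _ (star w * w)) swz.
  by [].
by [].
Qed.

End Path.

Lemma star_path_element w z d : star d = d ->
  star (path_element w z d) = path_element w z d.
Proof.
move=> ds; rewrite /path_element !starD !starM !starK ds !mulrA.
by rewrite [star w + w]addrC -!addrA; congr (_ + (_ + _)); rewrite addrCA.
Qed.

(** Up to [e], one recovers [d] from [q], [p] and [b] alone, and rebuilds the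
elements of [l] from their corners under [p]: as [v * p = v], the sum of conjugates only
depends on [p * g * p]. *)
Record encodes q d l (e : R) p b : Prop := Encodes {
  enc_projection : projection p;
  enc_corner : corner q p;
  enc_b_corner : corner q b;
  enc_b_star : star b = b;
  enc_b0 : p * b * p = 0;
  enc_recover : exists v1 v2 v3 d' : A,
    [/\ [/\ corner q v1, corner q v2 & corner q v3],
        [/\ v1 * p = v1, v2 * p = v2 & v3 * p = v3],
        forall C, unital_subalgebra C -> C q -> C p -> C b ->
          [/\ C v1, C v2, C v3 & C d'],
        rnorm (d - d') < e &
        forall g, g \in l -> rnorm (g - conj_sum v1 v2 v3 g) < e]
}.

Lemma corner_star q x : projection q -> corner q x -> corner q (star x).
Proof.
by move=> [_ qs] [qx xq]; split; rewrite -{1}qs -starM ?qx ?xq.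
Qed.

(** A splitting pair commuting with [q], [d] and [l] up to O(1/n) is chosen for
every [n]. All the elements defined from [p], [q] and [b] are then compressions,
up to O(1/n), of words in the splitting pair and [d] which are computed exactly;
the conclusion holds for [n] large. *)
Lemma exists_encoding q d l (e : R) : approximately_divisible A ->
  projection q -> corner q d -> star d = d -> (forall g, g \in l -> corner q g) ->
  0 < e -> exists p b, encodes q d l e p b.
Proof.
move=> hA qP qd ds lq e0; have [qq qs] := qP.
pose c (n : nat) : R := (32 * n.+1%:R)^-1.
have c0 n : 0 < c n by rewrite invr_gt0 mulr_gt0 // ltr0Sn.
(* The factor 32 keeps the defect of [q * E * q], which is at most [2 * c n],
   within the reach of [projection_near]. *)
have c32 n : c n <= 32^-1.
  by rewrite lef_pV2 ?posrE ?mulr_gt0 ?ltr0Sn // ler_peMr // ler1n.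
pose E (t : A * A * A) := t.1.1 * star t.1.1.
have /choice [t tP] (n : nat) : exists t : A * A * A,
    [/\ splitting_pair t.1.1 t.1.2,
        forall x y, x \in q :: d :: l ->
          y \in [:: t.1.1; star t.1.1; t.1.2; star t.1.2] ->
          rnorm (x * y - y * x) < c n,
        projection t.2, corner q t.2 & rnorm (t.2 - q * E t * q) <= 20 * c n].
  have [w [z [wz comm]]] := almost_central_splitting (q :: d :: l) hA (c0 n).
  pose h := q * (w * star w) * q.
  have hh : h * h - h = q * (w * star w) * (q * (w * star w) - w * star w * q) * q.
    rewrite /h mulrBr mulrBl !mulrA; congr (_ - _).
      by rewrite -(mulrA _ q q) qq.
    have -> : q * w * star w * w = q * w.
      by rewrite -!mulrA (mulrA w) (split_partial wz).
    by rewrite -(mulrA _ q q) qq.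
  have wn : rnorm w <= 1 := (rnorm_split wz).1.
  have qn := rnorm_projection qP.
  have cw := comm q w (mem_head _ _) (mem_head _ _).
  have cws : rnorm (q * star w - star w * q) < c n.
    by apply: comm; rewrite ?mem_head // !inE eqxx orbT.
  have comE : rnorm (q * (w * star w) - w * star w * q) <= 2 * c n.
    have -> : q * (w * star w) - w * star w * q =
        (q * w - w * q) * star w + w * (q * star w - star w * q).
      by rewrite mulrBl mulrBr !mulrA subrKA.
    apply: le_trans (rnormD _ _) _.
    have := rnormM (q * w - w * q) (star w); rewrite rnorm_star.
    have := rnormM w (q * star w - star w * q).
    have := rnorm_ge0 w; have := rnorm_ge0 (q * w - w * q).
    have := rnorm_ge0 (q * star w - star w * q); nra.
  have EP : projection (w * star w).
    by split; [rewrite mulrA (split_partial wz)|rewrite starM starK].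
  have En := rnorm_projection EP.
  have hn : rnorm (h * h - h) <= 2 * c n.
    rewrite hh; apply: le_trans (rnormM _ _) _.
    apply: le_trans (ler_wpM2l (rnorm_ge0 _) qn) _; rewrite mulr1.
    apply: le_trans (rnormM _ _) (le_trans _ comE).
    apply: ler_piMl; first exact: rnorm_ge0.
    apply: le_trans (rnormM _ _) _.
    by rewrite -[1]mulr1 ler_pM ?rnorm_ge0.
  have [] := projection_near qP (corner_sandwich (w * star w) qP).
  - by rewrite !starM starK qs mulrA.
  - by apply: le_trans hn _; have := c32 n; lra.
  move=> p [pP qp ph]; exists (w, z, p); split=> //=.
  by apply: le_trans ph _; rewrite -/h; lra.
pose w n := (t n).1.1; pose z n := (t n).1.2; pose p n := (t n).2.
have wz n : splitting_pair (w n) (z n) by have [] := tP n.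
have pP n : projection (p n) by have [] := tP n.
have qp n : corner q (p n) by have [] := tP n.
have bw : bounded w by exists 1 => n; have [] := rnorm_split (wz n).
have bz : bounded z by exists 1 => n; have [] := rnorm_split (wz n).
have bws := bounded_star bw; have bzs := bounded_star bz.
have bp : bounded p by exists 1 => n; exact: rnorm_projection.
have comm x (y : nat -> A) : x \in q :: d :: l ->
    (forall n, y n \in [:: w n; star (w n); z n; star (z n)]) ->
    almost_commute x y.
  move=> xl yP; exists 32^-1 => n; have [_ h _ _ _] := tP n.
  by have := ltW (h x (y n) xl (yP n)); rewrite /c invfM.
have cw x : x \in q :: d :: l -> almost_commute x w.
  by move=> xl; apply: comm => // n; rewrite !inE eqxx.
have cws x : x \in q :: d :: l -> almost_commute x (fun n => star (w n)).
  by move=> xl; apply: comm => // n; rewrite !inE eqxx ?orbT.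
have cz x : x \in q :: d :: l -> almost_commute x z.
  by move=> xl; apply: comm => // n; rewrite !inE eqxx ?orbT.
have czs x : x \in q :: d :: l -> almost_commute x (fun n => star (z n)).
  by move=> xl; apply: comm => // n; rewrite !inE eqxx ?orbT.
have ql : q \in q :: d :: l by rewrite mem_head.
have dl : d \in q :: d :: l by rewrite !inE eqxx orbT.
pose X n := path_element (w n) (z n) d.
have bs := boundedM bws bw.
have bX : bounded X.
  apply: boundedD; last first.
    by apply: boundedM => //; apply: boundedM => //; exact: bounded_const.
  by do 3![apply: boundedD => //].
have cs x : x \in q :: d :: l -> almost_commute x (fun n => star (w n) * w n).
  by move=> xl; apply: almost_commuteM => //; [exact: cws|exact: cw].
have cX : almost_commute q X.
  apply: almost_commuteD.
    do 3![apply: almost_commuteD => //; last by [exact: czs|exact: cz|exact: cws]].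
    exact: cw.
  apply: almost_commuteM (cs _ ql) => //.
    by apply: boundedM => //; exact: bounded_const.
  apply: almost_commuteM (cs _ ql) _ => //; first exact: bounded_const.
  by apply: almost_commute_const; have [-> ->] := qd.
(* The compression of [path_element], corrected to vanish exactly on [p]. *)
pose b n := q * X n * q - p n * X n * p n.
have pE : compresses_to q p (fun n => w n * star (w n)).
  split=> //; first exact: boundedM.
    by apply: almost_commuteM => //; [exact: cw|exact: cws].
  exists (20 / 32) => n; have [_ _ _ _] := tP n; rewrite /c /E -/(w n) -/(p n).
  by rewrite invfM -[20 / 32 / _]mulrA !mulrA.
have bX' : compresses_to q b X.
  have qXq : compresses_to q (fun n => q * X n * q) X.
    have bq := bounded_const q.
    split=> //; first by apply: boundedM => //; exact: boundedM.
    by apply: vanishing0 => n; rewrite subrr.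
  have := compressesD qXq (compressesN (compressesM qP (compressesM qP pE qXq) pE)).
  apply: eq_compresses => n; last first.
    by rewrite path_element_range0 // subr0.
  rewrite /b !mulrA (qp n).2 -!mulrA (qp n).1.
  by [].
have bst n : star (b n) = b n.
  by rewrite /b starB !starM qs (pP n).2 star_path_element // !mulrA.
(* [v2], [hop], [F], [v3] and [y] compress, in this order, [star w], [w],
   [star z * z], [star z * star w] and [w * d * star w]. *)
pose v2 n := b n * p n; pose hop n := p n * b n.
have hopw : compresses_to q hop w.
  by apply: eq_compresses (compressesM qP pE bX') => n; rewrite ?path_element_range.
have v2w : compresses_to q v2 (fun n => star (w n)).
  apply: eq_compresses (compresses_star qP hopw) => n //.
  by rewrite /hop starM bst (pP n).2.
pose F n := q - p n - v2 n * hop n.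
have Fz : compresses_to q F (fun n => star (z n) * z n).
  have := compressesD (compressesD (compresses_unit qP) (compressesN pE))
    (compressesN (compressesM qP v2w hopw)).
  apply: eq_compresses => n //; rewrite -(split_unit (wz n)).
  by rewrite -addrA -opprD addrC addKr.
pose v3 n := F n * b n * v2 n.
have v3z : compresses_to q v3 (fun n => star (z n) * star (w n)).
  apply: eq_compresses (compressesM qP (compressesM qP Fz bX') v2w) => n //.
  by rewrite path_element_z.
pose y n := hop n * b n * v2 n.
have yw : compresses_to q y (fun n => w n * d * star (w n)).
  apply: eq_compresses (compressesM qP (compressesM qP hopw bX') v2w) => n //.
  by rewrite path_element_w.
have gE g : g \in l -> vanishing (fun n => g - conj_sum (p n) (v2 n) (v3 n) g).
  move=> gl; have gl' : g \in q :: d :: l by rewrite !inE gl !orbT.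
  have gg := compresses_corner (lq g gl).
  apply: (compresses_recover (lq g gl) (compresses_conj_sum qP pE v2w v3z gg)).
  apply: conj_sum_vanishing => //; try exact: boundedM.
  - by apply: almost_commuteM => //; [exact: cw|exact: cws].
  - exact: cws.
  - by apply: almost_commuteM => //; [exact: czs|exact: cws].
  - by move=> n; exact: split_frame.
pose d' n := conj_sum (p n) (v2 n) (v3 n) (y n).
have dE : vanishing (fun n => d - d' n).
  apply: (compresses_recover qd (compresses_conj_sum qP pE v2w v3z yw)).
  apply: (@eq_vanishing _ _
    (fun n => d - conj_sum (w n) (star (w n) * w n) (star (z n)) d)).
    by move=> n; rewrite conj_sum_split_w.
  apply: conj_sum_vanishing => //; [exact: cw|exact: cs|exact: czs|].
  by move=> n; exact: split_frame_w.
have [N1 hN1] := vanishing_small dE e0.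
have [N2 hN2] := vanishing_small_seq gE e0.
pose n := maxn N1 N2.
have qb : corner q (b n).
  apply: cornerB; first exact: corner_sandwich.
  have [qpn pqn] := qp n.
  by split; rewrite ?mulrA ?qpn // -mulrA pqn.
have qv2 : corner q (v2 n) := cornerM qb (qp n).
have qhop : corner q (hop n) := cornerM (qp n) qb.
have qF : corner q (F n).
  apply: cornerB; last exact: cornerM.
  by apply: cornerB => //; exact: corner_id.
exists (p n), (b n); split=> //.
  rewrite /b mulrBr mulrBl !mulrA (qp n).2 (pP n).1 -!mulrA (pP n).1 (qp n).1.
  by rewrite subrr.
exists (p n), (v2 n), (v3 n), (d' n); split.
- by split=> //; apply: cornerM => //; exact: cornerM.
- by rewrite /v3 /v2 -!mulrA (pP n).1.
- move=> C [hC C1] Cq Cp Cb.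
  have CM x1 x2 : C x1 -> C x2 -> C (x1 * x2) := @cstar_sub_mul _ _ _ hC x1 x2.
  have CB x1 x2 : C x1 -> C x2 -> C (x1 - x2) := @cstar_subalgebraB _ _ C x1 x2 hC.
  have Cv2 : C (v2 n) by exact: CM.
  have Chop : C (hop n) by exact: CM.
  have CF : C (F n) by exact: (CB _ _ (CB _ _ Cq Cp) (CM _ _ Cv2 Chop)).
  have Cv3 : C (v3 n) by exact: (CM _ _ (CM _ _ CF Cb) Cv2).
  split=> //; have Cy : C (y n) by exact: (CM _ _ (CM _ _ Chop Cb) Cv2).
  have Cs x1 : C x1 -> C (star x1) := @cstar_sub_star _ _ _ hC x1.
  apply: (cstar_subalgebraD hC); first apply: (cstar_subalgebraD hC);
  by apply: (cstar_sub_mul hC); [exact: CM|exact: Cs].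
- by apply: hN1; rewrite leq_maxl.
- by move=> g gl; apply: hN2 => //; rewrite leq_maxr.
Qed.

End CornerEncoding.

(** * Extending a pair inside its free corner *)
Section States.
Variables (R : realType) (A : cstarAlgType R).
Implicit Types (x a b p q d g : A) (C : set A) (l : seq A).

Definition cartesian a b : A := a + ('i : R[i])%R *: b.

Lemma star_cartesian a b : star a = a -> star b = b ->
  star (cartesian a b) = a - ('i : R[i])%R *: b.
Proof.
by move=> sa sb; rewrite /cartesian starD starZ sa sb conjCi scaleNr.
Qed.

Lemma cartesian_parts C a b : cstar_subalgebra C -> star a = a -> star b = b ->
  C (cartesian a b) -> C a /\ C b.
Proof.
move=> hC sa sb Ct; have Cs := cstar_sub_star hC Ct.
have i0 : ('i : R[i])%R != 0 by rewrite neq0Ci.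
have two (y : A) : y = (2^-1 : R[i]) *: (y + y).
  by rewrite -mulr2n -(scaler_nat 2 y) scalerA mulVf ?scale1r // pnatr_eq0.
rewrite star_cartesian // in Cs; split.
  rewrite (two a); apply: cstar_subalgebraZ => //.
  have := cstar_subalgebraD hC Ct Cs.
  by rewrite /cartesian addrACA subrr addr0.
have -> : b = ('i : R[i])%R^-1 *: (('i : R[i])%R *: b).
  by rewrite scalerA mulVf // scale1r.
apply: cstar_subalgebraZ => //; rewrite (two (_ *: b)).
apply: cstar_subalgebraZ => //.
have := cstar_subalgebraB hC Ct Cs.
by rewrite /cartesian opprB addrC subrKA.
Qed.

Lemma exists_cartesian x : exists a b, [/\ star a = a, star b = b,
  x = cartesian a b &
  forall q, projection q -> corner q x -> corner q a /\ corner q b].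
Proof.
have i0 : ('i : R[i])%R != 0 by rewrite neq0Ci.
have half_real : Num.conj (2^-1 : R[i]) = 2^-1 by rewrite fmorphV rmorph_nat.
exists ((2^-1 : R[i]) *: (x + star x)).
exists ((2^-1 / 'i : R[i])%R *: (x - star x)); split.
- by rewrite starZ half_real starD starK addrC.
- rewrite starZ rmorphM /= half_real fmorphV /= conjCi starB starK.
  by rewrite invrN mulrN scaleNr -scalerN opprB.
- rewrite /cartesian scalerA mulrCA divff // mulr1 -scalerDr.
  rewrite addrACA subrr addr0 -mulr2n -(scaler_nat 2 x) scalerA.
  by rewrite mulVf ?scale1r // pnatr_eq0.
- move=> q qP qx; have qxs := corner_star qP qx.
  by split; apply: cornerZ; [exact: cornerD|exact: cornerB].
Qed.

Lemma cartesian_in C a b : cstar_subalgebra C -> C a -> C b ->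
  C (cartesian a b).
Proof.
by move=> hC Ca Cb; apply: cstar_subalgebraD => //; exact: cstar_subalgebraZ.
Qed.

Definition self_adjoint_corner q : set A :=
  [set d | corner q d /\ star d = d].

Lemma corner_sub_of_self_adjoint C q : projection q -> cstar_subalgebra C ->
  self_adjoint_corner q `<=` C -> corner q `<=` C.
Proof.
move=> qP hC h x qx; have [a [b [sa sb xE hq]]] := exists_cartesian x.
have [qa qb] := hq _ qP qx.
by rewrite xE; apply: cartesian_in => //; apply: h.
Qed.

(** In [state_gap], the bound [m] says how far [a] may still be altered inside the
corner under [q] without losing [q] as a limit of polynomials in [a]. *)
Record state a b q (m : R) : Prop := State {
  state_projection : projection q;
  state_a : star a = a;
  state_b : star b = b;
  state_aq : a * q = 0;
  state_qbq : q * b * q = 0;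
  state_gt0 : 0 < m;
  state_gap : forall r, corner q r -> rnorm r < m -> unital_hull [set a + r] q;
  state_full : unital_hull (cartesian a b |` self_adjoint_corner q) = setT
}.

Lemma projectionB p q : projection q -> projection p -> corner q p ->
  projection (q - p).
Proof.
move=> [qq qs] [pp ps] [qp pq]; split; last by rewrite starB qs ps.
by rewrite mulrBr !mulrBl qq qp pq pp subrr subr0.
Qed.

Lemma cornerW p q x : corner q p -> corner p x -> corner q x.
Proof.
by move=> [qp pq] [px xp]; split; [rewrite -px mulrA qp|rewrite -xp -mulrA pq].
Qed.

Lemma conj_sum_corner C p q v1 v2 v3 g s : cstar_subalgebra C ->
  projection p -> corner p `<=` C ->
  [/\ C v1, C v2 & C v3] -> [/\ v1 * p = v1, v2 * p = v2 & v3 * p = v3] ->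
  s = conj_sum v1 v2 v3 q -> C (s * g * s).
Proof.
move=> hC pP pC [C1 C2 C3] [p1 p2 p3] ->.
have term v v' : C v -> v * p = v -> C v' -> v' * p = v' ->
    C (v * q * star v * g * (v' * q * star v')).
  move=> Cv vp Cv' vp'.
  have vs : star v' = p * star v' by rewrite -[in LHS]vp' starM pP.2.
  have -> : v * q * star v * g * (v' * q * star v') =
      v * (p * (q * star v * g * v' * q) * p) * star v'.
    by rewrite !mulrA vp -(mulrA _ p (star v')) -vs.
  apply: (cstar_sub_mul hC); last exact: cstar_sub_star.
  by apply: (cstar_sub_mul hC) => //; apply: pC; exact: corner_sandwich.
have CD x y : C x -> C y -> C (x + y) := @cstar_subalgebraD _ _ C x y hC.
rewrite /conj_sum !mulrDl !mulrDr.
by apply: (CD); [apply: (CD)|]; (apply: (CD); [apply: (CD)|]); exact: term.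
Qed.

(** Coarse information suffices to see the whole corner under [q]: if [q] itself
is within 1/5 of a combination [s] of conjugates of [p], then [s g s] is within
half the norm of [g], and [s g s] only involves the corner under [p]. *)
Lemma corner_sub_of_smaller C p q v1 v2 v3 : cstar_subalgebra C ->
  projection q -> projection p -> corner p `<=` C ->
  [/\ C v1, C v2 & C v3] -> [/\ v1 * p = v1, v2 * p = v2 & v3 * p = v3] ->
  [/\ corner q v1, corner q v2 & corner q v3] ->
  rnorm (q - conj_sum v1 v2 v3 q) <= 5^-1 -> corner q `<=` C.
Proof.
move=> hC qP pP pC Cv vp [q1 q2 q3]; set s := conj_sum v1 v2 v3 q => qs5.
have qq := corner_id qP.
have qs : corner q s.
  apply: cornerD; first apply: cornerD;
  by apply: cornerM; [exact: cornerM|exact: corner_star].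
apply: corner_sub_of_half => // g qg; exists (s * g * s).
  exact: conj_sum_corner vp _.
split; first by apply: cornerB => //; apply: cornerM => //; exact: cornerM.
have -> : g - s * g * s = (q - s) * g + s * g * (q - s).
  rewrite mulrBl mulrBr qg.1 -[s * g * q]mulrA qg.2.
  by rewrite addrA subrK.
have qn := rnorm_projection qP.
have sn : rnorm s <= 6 / 5.
  have := rnormD (s - q) q; rewrite subrK rnormB; lra.
have n1 := rnormM (q - s) g; have n2 := rnormM (s * g) (q - s).
have n3 := rnormM s g; apply: le_trans (rnormD _ _) _.
have g0 := rnorm_ge0 g; have d0 := rnorm_ge0 (q - s).
have m1 := ler_wpM2r g0 qs5; have m3 := ler_wpM2r g0 sn.
have m2 := ler_pM (rnorm_ge0 (s * g)) d0 (le_trans n3 m3) qs5.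
lra.
Qed.

Lemma state_init : state 0 0 1 1.
Proof.
split; rewrite ?star0 ?mul0r ?mulr0 ?mul0r //.
- by split; [exact: mulr1|exact: star1].
- by move=> r _ _; exact: (unital_hullP _).2.
- apply/seteqP; split=> // x _.
  have [a [b [sa sb -> _]]] := exists_cartesian x.
  apply: (cartesian_in (unital_hullP _).1).
    by apply: sub_unital_hull; right; split=> //; split; rewrite ?mul1r ?mulr1.
  by apply: sub_unital_hull; right; split=> //; split; rewrite ?mul1r ?mulr1.
Qed.

Section Extension.
Variables (a b q : A) (m : R) (d : A) (l : seq A) (e : R) (p c : A) (k : R).
Hypothesis S : state a b q m.
Hypothesis E : encodes q d (q :: l) e p c.
Hypothesis k_gt0 : 0 < k.
Hypothesis km : k * 2 < m.

Let a' := a + k%:C *: (q - p).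
Let b' := b + k%:C *: c.
Let qP := state_projection S.
Let pP := enc_projection E.
Let qp := enc_corner E.
Let k0 : k%:C != 0 :> R[i].
Proof. by rewrite eq_complex /= eqxx andbT gt_eqF. Qed.

Lemma extension_a : star a' = a'.
Proof.
by rewrite /a' starD starZr (state_a S) starB qP.2 pP.2.
Qed.

Lemma extension_b : star b' = b'.
Proof. by rewrite /b' starD starZr (state_b S) (enc_b_star E). Qed.

Let qa : q * a = 0.
Proof. by rewrite -qP.2 -(state_a S) -starM (state_aq S) star0. Qed.

(** The gap of [state] gives [q], since [k (q - p) + r] is short. Then
[q (a' + r) / k = (q - p) + r / k], whose powers tend to [q - p]. *)
Lemma extension_gap r : corner p r -> rnorm r < k ->
  unital_hull [set a' + r] q /\ unital_hull [set a' + r] p.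
Proof.
move=> pr rk; set H := unital_hull _; have uH : unital_subalgebra H.
  exact: unital_hullP.
have [hH H1] := uH.
have dP := projectionB qP pP qp.
have qd : corner q (k%:C *: (q - p)).
  by apply: cornerZ; apply: cornerB qp; exact: corner_id.
have qr := cornerW qp pr.
have Har : H (a' + r) by apply: sub_unital_hull.
have Hq : H q.
  have -> : H = unital_hull [set a + (k%:C *: (q - p) + r)] by rewrite addrA.
  apply: (state_gap S); first exact: cornerD.
  apply: le_lt_trans (rnormD _ _) _; rewrite rnormZr gtr0_norm //.
  apply: le_lt_trans (lerD (ler_piMr (ltW k_gt0) (rnorm_projection dP)) (ltW rk)) _.
  by rewrite -mulr2n -mulr_natr.
split=> //; have -> : p = q - (q - p) by rewrite opprB addrC subrK.
apply: (cstar_subalgebraB hH) => //.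
have [rp1 rp2] : (q - p) * (k^-1%:C *: r) = 0 /\ (k^-1%:C *: r) * (q - p) = 0.
  rewrite -scalerAr -scalerAl mulrBl mulrBr qr.1 qr.2 pr.1 pr.2 subrr.
  by rewrite scaler0.
apply: (projection_of_power (y := k^-1%:C *: r) uH) => //; first exact: dP.1.
  by rewrite rnormZr gtr0_norm ?invr_gt0 // mulrC ltr_pdivrMr ?mul1r.
have -> : q - p + k^-1%:C *: r = k^-1%:C *: (q * (a' + r)).
  rewrite !mulrDr qa add0r -scalerAr mulrBr qP.1 qp.1 qr.1 scalerDr scalerA.
  by rewrite -rmorphM mulVf ?gt_eqF // scale1r.
by apply: (cstar_subalgebraZ _ hH); exact: (cstar_sub_mul hH).
Qed.

Let H := unital_hull [set cartesian a' b'].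

Lemma extension_hull : [/\ H q, H p & H c].
Proof.
have [hH H1] : unital_subalgebra H by exact: unital_hullP.
have [Ha Hb] : H a' /\ H b'.
  apply: (cartesian_parts hH) => //; [exact: extension_a|exact: extension_b|].
  exact: sub_unital_hull.
have [||Hq Hp] := @extension_gap 0.
- by split; rewrite ?mul0r ?mulr0.
- by rewrite rnorm0.
have sub : unital_hull [set a' + 0] `<=` H.
  by apply: unital_hull_min => // x ->; rewrite addr0.
split; [exact: sub|exact: sub|].
have -> : c = k^-1%:C *: (q * b' * q).
  rewrite mulrDr mulrDl (state_qbq S) add0r -scalerAr -scalerAl.
  have [-> ->] := enc_b_corner E.
  by rewrite scalerA -rmorphM mulVf ?gt_eqF // scale1r.
apply: (cstar_subalgebraZ _ hH).
have CM := cstar_sub_mul hH; apply: (CM); last exact: sub.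
by apply: (CM) => //; exact: sub.
Qed.

(** For fullness, the algebra generated by the new pair and the corner under [p]
contains the corner under [q], hence the correction [k (q - p) + i k c], hence the
old pair. *)
Lemma extension_state : e <= 5^-1 -> state a' b' p k.
Proof.
move=> e5; split=> //; [exact: extension_a|exact: extension_b| | | |].
- rewrite mulrDl -scalerAl mulrBl qp.1 pP.1 subrr scaler0 addr0.
  by rewrite -qp.1 mulrA (state_aq S) mul0r.
- rewrite mulrDr mulrDl -scalerAr -scalerAl (enc_b0 E) scaler0 addr0.
  have -> : p * b * p = p * (q * b * q) * p.
    by rewrite !mulrA qp.2 -(mulrA _ q p) qp.1.
  by rewrite (state_qbq S) mulr0 mul0r.
- by move=> r pr rk; have [] := extension_gap pr rk.
set C := unital_hull _; have uC : unital_subalgebra C by exact: unital_hullP.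
have [hC C1] := uC.
have Ct : C (cartesian a' b') by apply: sub_unital_hull; left.
have HC : H `<=` C by apply: unital_hullS => x ->; left.
have [/HC Cq /HC Cp /HC Cc] := extension_hull.
have [v1 [v2 [v3 [d' [qv vp vC _ vq]]]]] := enc_recover E.
have [Cv1 Cv2 Cv3 _] := vC C uC Cq Cp Cc.
have pC : corner p `<=` C.
  apply: corner_sub_of_self_adjoint => // x px.
  by apply: sub_unital_hull; right.
have qC : corner q `<=` C.
  apply: (corner_sub_of_smaller hC qP pP pC _ vp qv) => //.
  by apply: le_trans e5; apply: ltW; apply: vq; rewrite mem_head.
apply/seteqP; split=> // x _; have : unital_hull
  (cartesian a b |` self_adjoint_corner q) x by rewrite (state_full S).
apply: unital_hull_min => // y [->|[/qC]] //.
have [Ca Cb] : C a' /\ C b'.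
  by apply: (cartesian_parts hC) Ct => //; [exact: extension_a|exact: extension_b].
have -> : a = a' - k%:C *: (q - p) by rewrite addrK.
have -> : b = b' - k%:C *: c by rewrite addrK.
apply: (cartesian_in hC); apply: (cstar_subalgebraB hC) => //;
  apply: (cstar_subalgebraZ _ hC) => //; exact: (cstar_subalgebraB hC).
Qed.

End Extension.
End States.

(** * The generator *)
Section Generator.
Variables (R : realType) (A : cstarAlgType R).
Implicit Types (x a b p q d g : A) (C : set A) (l : seq A).

Hypothesis hA : approximately_divisible A.

Lemma cartesianB a b x y (k : R) :
  cartesian (a + k%:C *: x) (b + k%:C *: y) - cartesian a b =
  k%:C *: cartesian x y.
Proof.
rewrite /cartesian scalerDr scalerA addrACA [LHS]addrAC subrr add0r.
by rewrite scalerDr scalerA mulrC.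
Qed.

(** The elements of [l] are encoded one after the other. When the first one is
encoded, the others are replaced by their corners under the new projection, from
which they can be rebuilt; stability covers the errors. *)
Lemma absorb_list l a b q (m : R) x (dl e : R) : state a b q m ->
  (forall d, d \in l -> corner q d /\ star d = d) ->
  unital_hull (cartesian a b |` [set` l]) x -> 0 < dl -> 0 < e ->
  exists a' b' q' m' x', [/\ state a' b' q' m',
    rnorm (cartesian a' b' - cartesian a b) < dl,
    unital_hull [set cartesian a' b'] x' & rnorm (x - x') < e].
Proof.
have [n ln] : exists n, size l = n by exists (size l).
elim: n l ln a b q m x dl e => [|n IH] [|d l] //.
  move=> _ a b q m x dl e S lq hx dl0 e0.
  exists a, b, q, m, x; split=> //; rewrite ?subrr ?rnorm0 //.
  by apply: unital_hullS hx => y [|] //=; rewrite in_nil.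
move=> [ln] a b q m x dl e S lq hx dl0 e0.
have e2 : 0 < e / 2 by rewrite divr_gt0.
have d2 : 0 < dl / 2 by rewrite divr_gt0.
have [r r0 near] := unital_hull_stable hx e2.
pose r' := Num.min r 5^-1.
have r'0 : 0 < r' by rewrite lt_min r0 invr_gt0 ltr0n.
have qP := state_projection S.
have [qd ds] := lq d (mem_head _ _).
have lq' g : g \in q :: l -> corner q g.
  rewrite inE => /orP [/eqP ->|gl]; first exact: corner_id.
  by have [] := lq g; rewrite ?inE ?gl ?orbT.
have [p [c E]] := exists_encoding hA qP qd ds lq' r'0.
pose M := rnorm (cartesian (q - p) c).
have M0 : 0 <= M := rnorm_ge0 _; have m0 := state_gt0 S.
pose s := Num.min (dl / 2) r / (M + 1).
have s0 : 0 < s by rewrite divr_gt0 ?lt_min ?d2 // ltr_wpDl.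
pose k := Num.min s (m / 4).
have k0 : 0 < k by rewrite lt_min s0 divr_gt0.
have km : k * 2 < m.
  have : k <= m / 4 by rewrite ge_min lexx orbT.
  lra.
have kM : k * M < Num.min (dl / 2) r.
  have ks : k <= s by rewrite ge_min lexx.
  apply: le_lt_trans (ler_wpM2r M0 ks) _.
  rewrite /s mulrAC ltr_pdivrMr ?ltr_wpDl //.
  by rewrite ltr_pM2l ?lt_min ?d2 // ltrDl.
have r5 : r' <= 5^-1 by rewrite ge_min lexx orbT.
have S' := extension_state S E k0 km r5.
have [Hq Hp Hc] := extension_hull S E k0 km.
set a1 := a + _ in S' Hq Hp Hc; set b1 := b + _ in S' Hq Hp Hc.
have dist : rnorm (cartesian a1 b1 - cartesian a b) = k * M.
  by rewrite cartesianB rnormZr gtr0_norm.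
set H := unital_hull _ in Hq Hp Hc.
have uH : unital_subalgebra H by exact: unital_hullP.
have pP := enc_projection E.
have [v1 [v2 [v3 [d' [_ [vp1 vp2 vp3] vC dd' vg]]]]] := enc_recover E.
have [Cv1 Cv2 Cv3 Cd'] := vC H uH Hq Hp Hc.
have rr : r' <= r by rewrite ge_min lexx.
pose l' := [seq p * g * p | g <- l].
have approx : approximates r (cartesian a b |` [set` d :: l])
    (unital_hull (cartesian a1 b1 |` [set` l'])).
  have HU : H `<=` unital_hull (cartesian a1 b1 |` [set` l']).
    by apply: unital_hullS => y ->; left.
  move=> y [->|].
    exists (cartesian a1 b1); first by apply: sub_unital_hull; left.
    by rewrite rnormB dist; move: kM; rewrite lt_min => /andP [].
  rewrite /= inE => /orP [/eqP ->|yl].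
    by exists d'; [exact: HU|exact: lt_le_trans dd' rr].
  exists (conj_sum v1 v2 v3 (p * y * p)); last first.
    have -> : conj_sum v1 v2 v3 (p * y * p) = conj_sum v1 v2 v3 y.
      have vs v : v * p = v -> v * (p * y * p) * star v = v * y * star v.
        move=> vp; rewrite !mulrA vp -(mulrA _ p (star v)).
        by rewrite -{1}pP.2 -starM vp.
      by rewrite /conj_sum !vs.
    by apply: lt_le_trans rr; apply: vg; rewrite inE yl orbT.
  have [hU _] := unital_hullP (cartesian a1 b1 |` [set` l']).
  have yU : unital_hull (cartesian a1 b1 |` [set` l']) (p * y * p).
    by apply: sub_unital_hull; right; apply/mapP; exists y.
  have vU v : H v -> unital_hull (cartesian a1 b1 |` [set` l'])
      (v * (p * y * p) * star v).
    move=> /HU Uv; apply: (cstar_sub_mul hU); last exact: (cstar_sub_star hU).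
    exact: (cstar_sub_mul hU).
  have UD := @cstar_subalgebraD _ _ _ _ _ hU.
  by apply: (UD); first apply: (UD); exact: vU.
have [x1 hx1 xx1] := near _ approx.
have {}hx1 : unital_hull (cartesian a1 b1 |` [set` l']) x1.
  exact: (unital_hull_min (unital_hullP _) _ hx1).
have lp g : g \in l' -> corner p g /\ star g = g.
  move=> /mapP [y yl ->]; split; first exact: corner_sandwich.
  have [_ ys] : corner q y /\ star y = y by apply: lq; rewrite inE yl orbT.
  by rewrite !starM pP.2 ys mulrA.
have ln' : size l' = n by rewrite size_map.
have [a2 [b2 [q2 [m2 [x2 [S2 dist2 hx2 xx2]]]]]] := 
  IH l' ln' _ _ _ _ _ _ _ S' lp hx1 d2 e2.
exists a2, b2, q2, m2, x2; split=> //.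
  apply: le_lt_trans (rnormD3 _ (cartesian a1 b1) _) _; rewrite dist.
  by move: kM; rewrite lt_min => /andP [kd _]; lra.
by apply: le_lt_trans (rnormD3 _ x1 _) _; lra.
Qed.

Lemma absorb a b q (m : R) x (dl e : R) : state a b q m -> 0 < dl -> 0 < e ->
  exists a' b' q' m' x', [/\ state a' b' q' m',
    rnorm (cartesian a' b' - cartesian a b) < dl,
    unital_hull [set cartesian a' b'] x' & rnorm (x - x') < e].
Proof.
move=> S dl0 e0; have e2 : 0 < e / 2 by rewrite divr_gt0.
have hx : unital_hull (cartesian a b |` self_adjoint_corner q) x.
  by rewrite (state_full S).
have [l lq [y hy xy]] := unital_hull_finite hx e2.
have [a' [b' [q' [m' [x' [S' dist hx' yx']]]]]] := absorb_list S lq hy dl0 e2.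
exists a', b', q', m', x'; split=> //.
by apply: le_lt_trans (rnormD3 _ y _) _; lra.
Qed.

(** The last component of the states carried along is a tolerance: the distance at
which all the later terms must stay. It is at least halved at each step, and each
move is at most half of the current one, so the limit stays within it. *)
Lemma exists_cartesian_near (f : nat -> A) (e : nat -> R) :
  (forall n, 0 < e n) -> exists a b, [/\ star a = a, star b = b &
    forall n, exists2 x, unital_hull [set cartesian a b] x &
      rnorm (f n - x) < e n].
Proof.
move=> e0.
pose S (s : A * A * R) := exists q m, state s.1.1 s.1.2 q m /\ 0 < s.2.
pose T (s : A * A * R) := cartesian s.1.1 s.1.2.
have /choice [F FP] (ns : nat * (A * A * R)) : exists s',
    S ns.2 -> [/\ S s', rnorm (T s' - T ns.2) <= ns.2.2 / 2,
      s'.2 <= ns.2.2 / 2 &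
      forall t, rnorm (T s' - t) <= s'.2 ->
        exists2 x, unital_hull [set t] x & rnorm (f ns.1 - x) < e ns.1].
  have [[q [m [St d0]]]|nS] := pselect (S ns.2); last by exists ns.2.
  have d2 : 0 < ns.2.2 / 2 by rewrite divr_gt0.
  have e2 : 0 < e ns.1 / 2 by rewrite divr_gt0.
  have [a' [b' [q' [m' [x' [S' dist hx' xx']]]]]] := absorb (f ns.1) St d2 e2.
  have [r r0 near] := unital_hull_stable hx' e2.
  exists (a', b', Num.min (ns.2.2 / 2) (r / 2)) => _; split=> /=.
  - by exists q', m'; rewrite lt_min d2 divr_gt0.
  - exact: ltW.
  - by rewrite ge_min lexx.
  - move=> t; rewrite le_min => /andP [_ tr].
    have [|x hx xx] := near [set t].
      by move=> _ ->; exists t => //; apply: le_lt_trans tr _; lra.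
    by exists x => //; apply: le_lt_trans (rnormD3 _ x' _) _; lra.
pose s n := nat_rect (fun=> (A * A * R)%type) (0, 0, 1) (fun n s => F (n, s)) n.
have sS n : S (s n).
  elim: n => [|n IH]; first by exists 1, 1; split; [exact: state_init|exact: ltr01].
  by have [] := FP (n, s n) IH.
have s1 n := FP (n, s n) (sS n).
have dpos n : 0 < (s n).2 by have [q [m [_]]] := sS n.
have [||t tP] := @rnorm_cauchy_lim _ _ (T \o s) (fun n => (s n).2).
- move=> n m /subnKC <-; move: (m - n)%N => j {m}.
  suff : rnorm (T (s (n + j)%N) - T (s n)) <= (s n).2 - (s (n + j)%N).2.
    by have := dpos (n + j)%N => /=; lra.
  elim: j => [|j IHj]; first by rewrite addn0 !subrr rnorm0.
  rewrite addnS; have [_ /= dT ds _] := s1 (n + j)%N.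
  apply: le_trans (rnormD3 _ (T (s (n + j)%N)) _) _.
  rewrite -/(s (n + j).+1) in dT ds *.
  by move: IHj dT ds => /=; lra.
- move=> d d0; have [] := @exprn_small R 2^-1 d _ d0.
    by apply/andP; split; lra.
  move=> n nd; exists n; apply: le_lt_trans _ nd.
  elim: n => [|n IH]; first by rewrite expr0.
  have [_ _ /= h _] := s1 n; apply: le_trans h _.
  by rewrite exprSr ler_pM2r ?invr_gt0.
have [a [b [sa sb tE _]]] := exists_cartesian t.
exists a, b; split=> // n; rewrite -tE.
have [_ _ _ /=] := s1 n; apply.
by rewrite rnormB; exact: (tP n.+1).
Qed.

Lemma dense_sequence : separable A -> exists f : nat -> A,
  forall x (e : R), 0 < e -> exists n, rnorm (x - f n) < e.
Proof.
move=> [S [/pcard_surjP [f fS] /dense_rnorm dS]]; exists f => x e e0.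
by have [y /fS [n _ <-] xy] := dS x e e0; exists n.
Qed.

Lemma exists_cartesian_generator : separable A -> exists a b,
  [/\ star a = a, star b = b & unital_hull [set cartesian a b] = setT].
Proof.
move=> /dense_sequence [f df].
(* Each term of the dense sequence has to be met with every precision. *)
pose dec n : nat * nat := odflt (0, 0)%N (unpickle n).
have [|a [b [sa sb near]]] := @exists_cartesian_near
  (fun n => f (dec n).1) (fun n => (dec n).2.+1%:R^-1).
  by move=> n; rewrite invr_gt0.
exists a, b; split=> //; apply/seteqP; split=> // x _.
have [hH _] := unital_hullP [set cartesian a b].
apply: (iffLR (closed_rnormP _) (cstar_sub_closed hH)) => e e0.
have e2 : 0 < e / 2 by rewrite divr_gt0.
have [i xi] := df x _ e2.
have ei : 0 <= (e / 2)^-1 by rewrite invr_ge0 ltW.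
pose j := Num.Def.archi_bound (e / 2)^-1.
have je : j.+1%:R^-1 < e / 2.
  rewrite -[e / 2]invrK ltf_pV2 ?posrE ?invr_gt0 ?ltr0Sn //.
  by apply: lt_trans (archi_boundP ei) _; rewrite ltr_nat.
have [y hy] := near (pickle (i, j)); rewrite /dec pickleK /= => iy.
exists y => //; apply: le_lt_trans (rnormD3 _ (f i) _) _.
by have := ltrD xi (lt_trans iy je); rewrite -splitr.
Qed.

(** Adding a large multiple of the unit makes the first generator invertible, so
that the unit no longer has to be supplied separately. *)
Lemma nonunital_generation a b : star a = a -> star b = b ->
  unital_hull [set cartesian a b] = setT ->
  exists a', star a' = a' /\ forall C, cstar_subalgebra C ->
    C a' -> C b -> C = setT.
Proof.
move=> sa sb hT; pose s := rnorm a + 1.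
have a0 := rnorm_ge0 a; have s0 : 0 < s by rewrite /s; lra.
exists (a + s%:C *: 1); split; first by rewrite starD starZr star1 sa.
move=> C hC Ca Cb.
have C1 : C 1.
  apply: (@unit_of_contraction _ _ C (- (s^-1%:C *: a))) => //.
    rewrite rnormN rnormZr gtr0_norm ?invr_gt0 //.
    by rewrite mulrC ltr_pdivrMr // mul1r /s; lra.
  have -> : 1 - - (s^-1%:C *: a) = s^-1%:C *: (a + s%:C *: 1).
    rewrite opprK scalerDr scalerA -rmorphM mulVf ?gt_eqF // scale1r.
    by rewrite addrC.
  exact: cstar_subalgebraZ.
apply/seteqP; split=> // x _; have : unital_hull [set cartesian a b] x.
  by rewrite hT.
apply: unital_hull_min; first by [].
move=> _ ->; apply: cartesian_in => //.
have -> : a = a + s%:C *: 1 - s%:C *: 1 by rewrite addrK.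
by apply: cstar_subalgebraB => //; exact: cstar_subalgebraZ.
Qed.

End Generator.

Theorem theorem3p1 (R : realType) (A : cstarAlgType R) :
  separable A -> approximately_divisible A ->
  singly_generated A /\
  (exists a b : A, [/\ self_adjoint a, self_adjoint b &
     cstar_generated [set a; b] = setT]).
Proof.
move=> sepA hA; have [a [b [sa sb hT]]] := exists_cartesian_generator hA sepA.
have [a' [sa' gen]] := nonunital_generation sa sb hT.
split.
  exists (cartesian a' b).
  have hC := cstar_generated_subalgebra [set cartesian a' b].
  have [] := cartesian_parts hC sa' sb; last exact: gen.
  exact: sub_gen_smallest.
exists a', b; split=> //; apply: gen; first exact: cstar_generated_subalgebra.
  by apply: sub_gen_smallest; left.
by apply: sub_gen_smallest; right.
Qed.
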